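(* Let $L$ be a minimal aperiodic shift with linear complexity, and let $\mu$ be a $\sigma$-invariant Borel probability measure on $L$. Then $(L,\sigma)$ is topologically conjugate to $(\hat I,\hat T)$ via the homeomorphism $\phi$, $\hat T$ extends $T_L|_I$, and $T_L|_I$ is an almost finite interval exchange transformation.
   Context: Words, shifts and orders. Let $A$ be a finite alphabet with a total order, extended lexicographically to $A^{\mathbb N}$, which carries the Cantor (product) topology. The shift map is $\sigma(a_0a_1\dots)=a_1a_2\dots$. A shift is a closed $L\subseteq A^{\mathbb N}$ with $\sigma(L)\subseteq L$. $Fact_L(n)$ is the set of length-$n$ factors of words of $L$ and $p_L(n)=|Fact_L(n)|$. $L$ has linear complexity if $p_L(n)=O(n)$. $L$ is minimal if it has no nonempty proper closed $\sigma$-invariant subset, and aperiodic if it is not the orbit of one periodic word. For $w\le w'$ in $L$, $[w,w']=\{w''\in L:w\le w''\le w'\}$, and $w_{L,min}$ denotes the smallest word of $L$. Construction. Put $\phi_\mu(w)=\mu([w_{L,min},w])$. Let $Z_0$ be the set of $x\in[0,1]$ with $|\phi_\mu^{-1}(x)|\ge 2$; each such preimage consists of exactly two consecutive words. Let $\hat I=[0,1]\sqcup Z_0^-$, where $Z_0^-=\{z^-:z\in Z_0\}$ is a disjoint copy of $Z_0$. Order $\hat I$ so that $z^-<z$ with nothing in between, extending the order of $[0,1]$, and give it the order topology. Let $\iota$ be the inclusion $[0,1]\to\hat I$, and let $\kappa:\hat I\to[0,1]$ be the identity on $[0,1]$ with $z^-\mapsto z$. Define $\phi(w)=(\phi_\mu(w))^-$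 if $\phi_\mu^{-1}(\phi_\mu(w))=\{w,w'\}$ with $w<w'$, and $\phi(w)=\phi_\mu(w)$ otherwise. Set $\hat T=\phi\sigma\phi^{-1}$ and $T_L=\kappa\circ\hat T\circ\iota$, with $I=[0,1)$. IET (finite or infinite). A finite IET is an injective $T:I\to I$ that is a translation on each interval $[x_i,x_{i+1})$ of a finite partition $0=x_0<\dots<x_m=1$. An infinite IET is a map $T:I\to I$ with an infinite set $Y$ of discontinuities whose closure ${\cal D}$ in $I$ is Lebesgue-null. Letting ${\cal D}_{acc,r}$ be the right-accumulation points of ${\cal D}$, $T$ is required to be injective on $I\setminus{\cal D}_{acc,r}$, right-continuous, and a translation on each right-open interval $[x,x')$ with $x\in{\cal D}$, $x'\in{\cal D}\cup\{1\}$, $[x,x')\cap Y\subseteq\{x\}$. Almost finite. An IET $T$ with discontinuity set ${\cal D}$ (the closure of its discontinuities) is almost finite if: (1) there is a finite partition of $I$ into right-open intervals on each of which $T$ is increasing; (2) the set of accumulation points of ${\cal D}$ is finite; (3) ${\cal D}$ is contained in a union of finitely many full orbits of $T$. Here the full orbit of $x$ is its class under the relation $x'\sim x$ iff $T^{n_1}(x')=T^{n_2}(x)$ for some $n_1,n_2\ge0$. *)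

(* Defs.v *)
From HB Require Import structures.
From mathcomp Require Import all_boot all_order all_algebra.
From mathcomp Require Import all_classical all_reals all_analysis.
Import Order.TTheory GRing.Theory Num.Theory.
Local Open Scope classical_set_scope.
Local Open Scope ring_scope.


Definition word {A : Type} (a0 : A) := nat -> A.
HB.instance Definition _ (A : Type) (a0 : A) := gen_eqMixin (word a0).
HB.instance Definition _ (A : Type) (a0 : A) := gen_choiceMixin (word a0).
HB.instance Definition _ (A : Type) (a0 : A) := isPointed.Build (word a0) (fun _ => a0).

Section Words.
Context {dA : Order.disp_t} {A : finOrderType dA}.

Definition shiftw (w : nat -> A) : nat -> A := fun n => w n.+1.

Definition lex_lt (w w' : nat -> A) : Prop :=
  exists n, (forall i, (i < n)%N -> w i = w' i) /\ (w n < w' n)%O.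
Definition lex_le (w w' : nat -> A) : Prop := w = w' \/ lex_lt w w'.

Definition cantor_open (U : set (nat -> A)) : Prop :=
  forall w, U w -> exists n, forall w',
    (forall i, (i < n)%N -> w' i = w i) -> U w'.
Definition cantor_closed (F : set (nat -> A)) : Prop := cantor_open (~` F).

Definition rel_open (L U : set (nat -> A)) : Prop :=
  U `<=` L /\ forall w, U w -> exists n, forall w', L w' ->
    (forall i, (i < n)%N -> w' i = w i) -> U w'.

Definition is_shift (L : set (nat -> A)) : Prop :=
  cantor_closed L /\ (forall w, L w -> L (shiftw w)).

Definition minimal_shift (L : set (nat -> A)) : Prop :=
  forall M : set (nat -> A), M `<=` L -> M !=set0 -> cantor_closed M ->
    (forall w, M w -> M (shiftw w)) -> M = L.

Definition aperiodic (L : set (nat -> A)) : Prop :=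
  ~ exists (u : nat -> A) (p : nat), (0 < p)%N /\ (forall i, u (i + p)%N = u i) /\
      L = range (fun k => iter k shiftw u).

Definition Fact (L : set (nat -> A)) (n : nat) : set (n.-tuple A) :=
  [set t | exists w k, L w /\ forall i : 'I_n, tnth t i = w (k + i)%N].
Definition complexity (L : set (nat -> A)) (n : nat) : nat :=
  #|finset (fun t : n.-tuple A => `[< Fact L n t >])|.
Definition linear_complexity (L : set (nat -> A)) : Prop :=
  exists C N : nat, forall n, (N <= n)%N -> (complexity L n <= C * n)%N.

End Words.

(** Borel sigma-algebra on A^N (generated by the open sets); the point a0
    is only needed because measurable types are pointed in mathcomp-analysis *)
Definition Wmeas {dA : Order.disp_t} {A : finOrderType dA} (a0 : A) :=
  g_sigma_algebraType (cantor_open : set (set (word a0))).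

Section Construction.
Context {R : realType} {dA : Order.disp_t} {A : finOrderType dA} {a0 : A}.
Variables (L : set (nat -> A)) (mu : probability (Wmeas a0) R).

(** phi_mu(w) = mu([w_{L,min}, w]) ; [w_{L,min}, w] = {v in L | v <= w} *)
Definition phi_mu (w : nat -> A) : R :=
  fine (mu [set v | L v /\ lex_le v w]).

Definition Z0 (x : R) : Prop :=
  0 <= x <= 1 /\
  exists w1 w2, [/\ L w1, L w2, w1 <> w2, phi_mu w1 = x & phi_mu w2 = x].

(** hat I = [0,1] disjoint-union Z_0^- : (x, false) is x in [0,1],
    (x, true) is x^- for x in Z_0 *)
Definition Ihat : set (R * bool) :=
  [set p | 0 <= p.1 <= 1 /\ (p.2 = true -> Z0 p.1)].

Definition ihat_lt (p q : R * bool) : Prop :=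
  p.1 < q.1 \/ (p.1 = q.1 /\ p.2 = true /\ q.2 = false).

(** the order topology on hat I (basis: open intervals and open rays) *)
Definition ihat_open (U : set (R * bool)) : Prop :=
  U `<=` Ihat /\ forall p, U p -> exists lo hi : option (R * bool),
    [/\ (match lo with Some a => Ihat a /\ ihat_lt a p | None => True end),
        (match hi with Some b => Ihat b /\ ihat_lt p b | None => True end) &
        forall q, Ihat q ->
          (match lo with Some a => ihat_lt a q | None => True end) ->
          (match hi with Some b => ihat_lt q b | None => True end) -> U q].

Definition phi (w : nat -> A) : R * bool :=
  let x := phi_mu w in
  if `[< exists w', lex_lt w w' /\
          forall v, (L v /\ phi_mu v = x) <-> (v = w \/ v = w') >]
  then (x, true) else (x, false).

Definition That (p : R * bool) : R * bool :=
  match pselect (exists w, L w /\ phi w = p) with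
  | left H => phi (shiftw (proj1_sig (cid H)))
  | right _ => p
  end.

Definition iotaI (x : R) : R * bool := (x, false).
Definition kappaI (p : R * bool) : R := p.1.
Definition T_L (x : R) : R := kappaI (That (iotaI x)).

End Construction.

Section IET.
Context {R : realType}.
Implicit Types (T : R -> R) (x : R).

Definition inI x : Prop := 0 <= x < 1.

Definition maps_I T : Prop := forall x, inI x -> inI (T x).

Definition contI T x : Prop :=
  forall e, 0 < e -> exists d, 0 < d /\
    forall y, inI y -> `|y - x| < d -> `|T y - T x| < e.

Definition discont T : set R := [set x | inI x /\ ~ contI T x].

Definition closI (Y : set R) : set R :=
  [set x | inI x /\ forall e, 0 < e -> exists y, Y y /\ `|y - x| < e].

Definition Dset T : set R := closI (discont T).

Definition right_acc (D : set R) : set R :=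
  [set x | forall e, 0 < e -> exists y, D y /\ x < y < x + e].

Definition translation_on T (a b : R) : Prop :=
  exists c, forall y, a <= y < b -> T y = y + c.

Definition right_continuous_I T : Prop :=
  forall x, inI x -> forall e, 0 < e -> exists d, 0 < d /\
    forall y, inI y -> x <= y < x + d -> `|T y - T x| < e.

Definition finite_IET T : Prop :=
  [/\ maps_I T,
      (forall x y, inI x -> inI y -> T x = T y -> x = y) &
      exists (m : nat) (xs : nat -> R),
        [/\ xs 0%N = 0, xs m = 1,
            (forall i, (i < m)%N -> xs i < xs i.+1) &
            (forall i, (i < m)%N -> translation_on T (xs i) (xs i.+1))]].

Definition infinite_IET T : Prop :=
  let Y := discont T in
  let D := closI Y in
  [/\ maps_I T, ~ finite_set Y /\ (@lebesgue_measure R).-negligible D,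
      (forall x y, inI x -> inI y -> ~ right_acc D x -> ~ right_acc D y ->
          T x = T y -> x = y),
      right_continuous_I T &
      forall x x', D x -> (D x' \/ x' = 1) -> x < x' ->
        (forall y, Y y -> x <= y < x' -> y = x) -> translation_on T x x'].

Definition IET T : Prop := finite_IET T \/ infinite_IET T.

Definition same_full_orbit T x x' : Prop :=
  exists n1 n2 : nat, iter n1 T x' = iter n2 T x.

Definition almost_finite T : Prop :=
  let D := Dset T in
  [/\ (exists (m : nat) (xs : nat -> R),
         [/\ xs 0%N = 0, xs m = 1,
             (forall i, (i < m)%N -> xs i < xs i.+1) &
             (forall i, (i < m)%N -> forall y z, xs i <= y -> y < z -> z < xs i.+1 ->
                 T y < T z)]),
      finite_set [set x | forall e, 0 < e -> exists y, D y /\ y != x /\ `|y - x| < e]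
    & exists F : seq R, (forall f, f \in F -> inI f) /\
        forall d, D d -> exists2 f, f \in F & same_full_orbit T f d].

End IET.

(* Main.v *)
(** Invariance and minimality make [mu] non-atomic with full support on [L], so
    [phi_mu] identifies exactly the pairs of consecutive words of [L], and a point
    [x] of [[0, 1)] is represented by the unique word above [x] that is a limit of
    larger words of [L]; [T_L] is the shift read on these representatives.

    Near a word [w] whose shift has a single left extension, the shift preserves
    the measure of intervals, so [T_L] is a translation on both sides of
    [phi_mu w].  Linear complexity bounds the number of infinite left special
    words, hence the values where this fails; discontinuities can only
    accumulate there.

    Every other discontinuity comes from a word that is not a limit of smaller
    words.  If such a word is isolated from below at length [m], its [i]-th
    backward image is isolated at length at most [m + i]; and the words isolated
    at length [n] have pairwise distinct prefixes of length [n].  Hence [K] such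
    words in distinct orbits give [K * n <= p_L (m + n)], which bounds [K]. *)

Require Import Defs.
From HB Require Import structures.
From mathcomp Require Import all_boot all_order all_algebra.
From mathcomp Require Import all_classical all_reals all_analysis.
From mathcomp Require Import zify ring lra.
Import Order.TTheory GRing.Theory Num.Theory.
Local Open Scope classical_set_scope.
Local Open Scope ring_scope.

(** * Lexicographic order on infinite words *)

Section LexicographicOrder.
Context {dA : Order.disp_t} {A : finOrderType dA}.
Implicit Types (u v w s : nat -> A) (n : nat).

Definition agree n v w := forall i, (i < n)%N -> v i = w i.

Definition consw (a : A) w : nat -> A := fun n => if n is m.+1 then w m else a.

Lemma agree_refl n w : agree n w w. Proof. by []. Qed.

Lemma agree_sym n v w : agree n v w -> agree n w v.
Proof. by move=> h i /h. Qed.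

Lemma agree_trans n v u w : agree n v u -> agree n u w -> agree n v w.
Proof. by move=> h1 h2 i ni; rewrite h1 ?h2. Qed.

Lemma agree_le m n v w : (m <= n)%N -> agree n v w -> agree m v w.
Proof. by move=> mn h i im; apply: h; exact: leq_trans mn. Qed.

Lemma agree_eq v w : (forall n, agree n v w) -> v = w.
Proof. by move=> h; apply: funext => i; exact: (h i.+1). Qed.

Lemma neq_agree v w : v <> w -> exists n, agree n v w /\ v n <> w n.
Proof.
move=> vw; have ex : exists n, v n != w n.
  apply: contrapT => nex; apply: vw; apply: funext => i; apply/eqP.
  by apply: contrapT => /negP h; apply: nex; exists i.
case: (ex_minnP ex) => n /eqP vn hmin; exists n; split=> // i ni.
apply/eqP; apply: contrapT => /negP /hmin; by rewrite leqNgt ni.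
Qed.

Lemma agreeS n v w : agree n.+1 v w <-> v 0%N = w 0%N /\ agree n (shiftw v) (shiftw w).
Proof.
split=> [h|[h0 h]]; first by split=> [|i ni]; apply: h.
by case=> [//|i] ni; exact: h.
Qed.

Lemma consw_shiftw w : consw (w 0%N) (shiftw w) = w.
Proof. by apply: funext; case. Qed.

Lemma shiftw_inj v w : v 0%N = w 0%N -> shiftw v = shiftw w -> v = w.
Proof. by move=> h0 h; rewrite -(consw_shiftw v) -(consw_shiftw w) h0 h. Qed.

Lemma lex_ltxx w : ~ lex_lt w w.
Proof. by case=> n [_]; rewrite ltxx. Qed.

Lemma lex_lt_trans u v w : lex_lt u v -> lex_lt v w -> lex_lt u w.
Proof.
move=> [n [hn un]] [m [hm vm]]; case: (ltngtP n m) => [nm|mn|e].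
- exists n; split=> [i ni|]; last by rewrite -hm.
  by rewrite hn // hm // (ltn_trans ni).
- exists m; split=> [i mi|]; last by rewrite hn.
  by rewrite hn ?hm // (ltn_trans mi).
- subst m; exists n; split=> [i ni|]; first by rewrite hn ?hm.
  exact: lt_trans vm.
Qed.

Lemma lex_total v w : v <> w -> lex_lt v w \/ lex_lt w v.
Proof.
move=> /neq_agree[n [vw /eqP vn]]; case/orP: (lt_total vn) => h.
  by left; exists n.
by right; exists n; split=> // i /vw.
Qed.

Lemma lex_leP v w : lex_le v w <-> ~ lex_lt w v.
Proof.
split=> [[->|vw] wv|h]; first exact: lex_ltxx wv.
  exact: (@lex_ltxx v) (lex_lt_trans _ _ _ vw wv).
have [->|/lex_total[]] := EM (v = w); [by left|by right|by []].
Qed.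

Lemma lex_ltP v w : lex_lt v w <-> ~ lex_le w v.
Proof. by rewrite lex_leP; split=> [h nh//|/contrapT]. Qed.

Lemma lex_ltW v w : lex_lt v w -> lex_le v w. Proof. by right. Qed.

Lemma lex_lt_le_trans u v w : lex_lt u v -> lex_le v w -> lex_lt u w.
Proof. by move=> uv [<-//|]; exact: lex_lt_trans. Qed.

Lemma lex_le_trans u v w : lex_le u v -> lex_le v w -> lex_le u w.
Proof. by case=> [->//|uv vw]; right; exact: lex_lt_le_trans vw. Qed.

Lemma lex_le_anti v w : lex_le v w -> lex_le w v -> v = w.
Proof. by case=> // vw /lex_leP. Qed.

Lemma lex_le_total v w : lex_le v w \/ lex_le w v.
Proof. by have [h|/lex_ltP h] := EM (lex_le v w); [left|right; right]. Qed.

Lemma lex_lt_agree n v w s : agree n v w -> lex_lt v s -> ~ agree n v s ->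
  lex_lt w s.
Proof.
move=> vw [m [vs vsm]] nvs; have mn : (m < n)%N.
  by rewrite ltnNge; apply/negP => nm; apply: nvs => i ni; apply: vs; exact: leq_trans nm.
exists m; split=> [i im|]; last by rewrite -vw.
by rewrite -vw ?vs // (ltn_trans im).
Qed.

Lemma lex_gt_agree n v w s : agree n v w -> lex_lt s v -> ~ agree n v s ->
  lex_lt s w.
Proof.
move=> vw [m [vs vsm]] nvs; have mn : (m < n)%N.
  rewrite ltnNge; apply/negP => nm; apply: nvs => i ni.
  by rewrite vs //; exact: leq_trans nm.
exists m; split=> [i im|]; last by rewrite -vw.
by rewrite -vw ?vs // (ltn_trans im).
Qed.

Lemma lex_agree_between n u v w : lex_le u v -> lex_le v w -> agree n u w ->
  agree n u v.
Proof.
move=> uv vw a; apply: contrapT => na.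
have uv' : lex_lt u v by case: uv => // e; case: na; rewrite e.
by move/lex_leP: vw; apply; exact: lex_lt_agree a uv' na.
Qed.

Lemma lex_lt_open v w : lex_lt v w -> exists n, forall v' w',
  agree n v' v -> agree n w' w -> lex_lt v' w'.
Proof.
move=> [n [vw vwn]]; exists n.+1 => v' w' hv hw; exists n; split=> [i ni|].
  by rewrite hv ?hw ?vw // ltnW.
by rewrite hv ?hw.
Qed.

Lemma lex_le0 v w : lex_le v w -> (v 0%N <= w 0%N)%O.
Proof. by case=> [->//|[[|n] [h hn]]]; [exact: ltW|rewrite h]. Qed.

Lemma lex_lt0 v w : (v 0%N < w 0%N)%O -> lex_lt v w.
Proof. by exists 0%N. Qed.

Lemma lex_lt_shiftw v w : v 0%N = w 0%N -> lex_lt v w <-> lex_lt (shiftw v) (shiftw w).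
Proof.
move=> h0; split=> [[[|n] [h hn]]|[n [h hn]]].
- by move: hn; rewrite h0 ltxx.
- by exists n; split=> // i ni; exact: h.
- by exists n.+1; split=> // -[//|i] ni; exact: h.
Qed.

Lemma lex_le_shiftw v w : v 0%N = w 0%N -> lex_le v w <-> lex_le (shiftw v) (shiftw w).
Proof.
move=> h0; rewrite !lex_leP.
by have /lex_lt_shiftw -> : w 0%N = v 0%N by [].
Qed.

(** Pigeonhole on the finite alphabet: if every letter failed at some length, monotonicity would
    make all of them fail at the maximum of these lengths. It serves as the compactness argument for
    first letters. *)
Lemma ex_letter_forall (P : A -> nat -> Prop) :
  (forall a m n, (m <= n)%N -> P a n -> P a m) ->
  (forall n, exists a, P a n) -> exists a, forall n, P a n.
Proof.
move=> Pmono ex; apply: contrapT => nex.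
have /choice[f hf] : forall a, exists n, ~ P a n.
  move=> a; apply: contrapT => h; apply: nex; exists a => n.
  by apply: contrapT => h'; apply: h; exists n.
have [a ha] := ex (\max_a f a)%N.
by apply: (hf a); apply: Pmono ha; exact: leq_bigmax.
Qed.

Lemma cantor_closedP (F : set (nat -> A)) : cantor_closed F <->
  forall w, (forall n, exists v, F v /\ agree n v w) -> F w.
Proof.
split=> [Fc w h|h w Fw].
  apply: contrapT => Fw; have [n hn] := Fc w Fw.
  by have [v [Fv vw]] := h n; exact: hn Fv.
apply: contrapT => nex; apply: Fw; apply: h => n.
apply: contrapT => h; apply: nex; exists n => v vw Fv.
by apply: h; exists v.
Qed.

(* The minimum is built greedily, one letter at a time. *)
Lemma closed_lex_min (F : set (nat -> A)) : cantor_closed F -> F !=set0 ->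
  exists2 w, F w & forall v, F v -> lex_le w v.
Proof.
move=> /cantor_closedP Fc [v0 Fv0].
have step n (u : nat -> A) : F u -> exists u', [/\ F u', agree n u u' &
    forall v, F v -> agree n u v -> (u' n <= v n)%O].
  move=> Fu.
  pose Q := [pred a | `[< exists v, [/\ F v, agree n u v & v n = a] >]].
  have Qu : Q (u n) by apply/asboolP; exists u.
  case: (Order.TotalTheory.arg_minP (fun a : A => a) Qu) => a /asboolP[u' [Fu' a1 a2]] hmin.
  exists u'; split=> // v Fv uv; rewrite a2; apply: hmin.
  by apply/asboolP; exists v.
have /choice[f hf] : forall nu : nat * (nat -> A), exists u', F nu.2 ->
    [/\ F u', agree nu.1 nu.2 u' &
    forall v, F v -> agree nu.1 nu.2 v -> (u' nu.1 <= v nu.1)%O].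
  move=> [n u] /=; have [Fu|nFu] := EM (F u); last by exists u.
  by have [u' ?] := step n u Fu; exists u'.
pose g := fix g n := if n is m.+1 then f (m, g m) else v0.
have Fg n : F (g n) by elim: n => [//|n IH] /=; have [] := hf (n, g n) IH.
have agS n : agree n (g n) (g n.+1) by have [] := hf (n, g n) (Fg n).
have ag n k : agree n (g n) (g (n + k)%N).
  elim: k => [|k IH]; first by rewrite addn0.
  apply: agree_trans IH _; rewrite addnS; apply: agree_le (agS _); exact: leq_addr.
(* Letter [n] no longer changes from [g n.+1] on, so the diagonal is the limit of the words
   [g n]. *)
pose w : nat -> A := fun n => g n.+1 n.
have gw n : agree n (g n) w.
  by move=> i ni; rewrite /w -(subnKC ni); apply/esym; exact: ag.
exists w; first by apply: Fc => n; exists (g n).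
move=> v Fv; apply/lex_leP => -[n [vw vwn]].
have [_ _ /(_ v Fv)] := hf (n, g n) (Fg n); rewrite /= => hh.
have /hh : agree n (g n) v by move=> i ni; rewrite (gw n) // vw.
by rewrite leNgt => /negP; apply.
Qed.

End LexicographicOrder.

(** Reversing the order of the alphabet turns the minimum into a maximum. *)
Lemma closed_lex_max {dA : Order.disp_t} {A : finOrderType dA} (F : set (nat -> A)) :
  cantor_closed F -> F !=set0 ->
  exists2 w, F w & forall v, F v -> lex_le v w.
Proof.
move=> Fc F0; have [w Fw wmin] := @closed_lex_min _ A^d F Fc F0.
exists w => // v /wmin[->|[n [vw vwn]]]; first by left.
by right; exists n; split=> // i /vw.
Qed.

(** * Combinatorics of minimal shifts of linear complexity *)

Section Shifts.
Context {dA : Order.disp_t} {A : finOrderType dA}.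
Variable L : set (nat -> A).
Hypotheses (Lsh : is_shift L).
Implicit Types (u v w s : nat -> A) (n : nat).

Definition gap w w' := [/\ L w, L w', lex_lt w w' &
  forall v, L v -> lex_lt w v -> lex_le w' v].

Definition right_limit w := forall n, exists v, [/\ L v, lex_lt w v & agree n w v].

Definition left_limit w := forall n, exists v, [/\ L v, lex_lt v w & agree n w v].

Definition left_special u := exists a b : A,
  [/\ a <> b, L (consw a u) & L (consw b u)].

Definition orbit_equiv v w := exists i j, iter i shiftw v = iter j shiftw w.

Lemma shift_limit w : (forall n, exists v, L v /\ agree n v w) -> L w.
Proof. by have [/cantor_closedP h _] := Lsh; exact: h. Qed.

Lemma shift_shiftw w : L w -> L (shiftw w).
Proof. by have [_] := Lsh; apply. Qed.

Lemma shift_iter k w : L w -> L (iter k shiftw w).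
Proof. by move=> Lw; elim: k => //= k /shift_shiftw. Qed.

Lemma gap_lt w w' v : gap w w' -> L v -> lex_lt v w' -> lex_le v w.
Proof.
move=> [_ _ _ h] Lv vw'; apply/lex_leP => wv.
by have /lex_leP := h v Lv wv.
Qed.

Lemma gap_not_right_limit w w' : gap w w' -> ~ right_limit w.
Proof.
move=> [_ _ ww' h] r; have [n hn] := lex_lt_open _ _ ww'.
have [v [Lv wv a]] := r n.
by have /lex_leP := h v Lv wv; apply; apply: hn => //; exact: agree_sym.
Qed.

Lemma gap_not_left_limit w w' : gap w w' -> ~ left_limit w'.
Proof.
move=> g r; case: (g) => _ _ ww' _; have [n hn] := lex_lt_open _ _ ww'.
have [v [Lv wv a]] := r n.
have /lex_leP := gap_lt _ _ _ g Lv wv; apply; apply: hn => //; exact: agree_sym.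
Qed.

Lemma gap_uniq w w1 w2 : gap w w1 -> gap w w2 -> w1 = w2.
Proof. by move=> [_ L1 l1 h1] [_ L2 l2 h2]; apply: lex_le_anti; [exact: h1|exact: h2]. Qed.

(** If the larger words avoid some cylinder around [w], they form a closed set, and its least
    element is the successor of [w]. *)
Lemma max_gap_or_right_limit w : L w ->
  [\/ forall v, L v -> lex_le v w, exists w', gap w w' | right_limit w].
Proof.
move=> Lw; have [r|nr] := EM (right_limit w); first by constructor 3.
have [n hn] : exists n, forall v, L v -> lex_lt w v -> ~ agree n w v.
  apply: contrapT => h; apply: nr => n; apply: contrapT => h'; apply: h.
  by exists n => v Lv wv a; apply: h'; exists v.
have [m|nm] := EM (forall v, L v -> lex_le v w); first by constructor 1.
pose F := [set v | L v /\ lex_lt w v].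
have Fc : cantor_closed F.
  apply/cantor_closedP => v h; have Lv : L v.
    by apply: shift_limit => k; have [v' [[Lv' _] a]] := h k; exists v'.
  split=> //; have [v' [[Lv' wv'] a]] := h n.
  by apply: (lex_gt_agree n v') => // b; exact: hn Lv' wv' (agree_sym _ _ _ b).
have F0 : F !=set0.
  apply: contrapT => F0; apply: nm => v Lv; apply/lex_leP => wv.
  by apply: F0; exists v.
have [w' [Lw' ww'] hmin] := closed_lex_min F Fc F0.
by constructor 2; exists w'; split=> // v Lv wv; exact: hmin.
Qed.

Lemma right_limit_shiftw w : right_limit w -> right_limit (shiftw w).
Proof.
move=> r n; have [v [Lv wv /agreeS[a0 a]]] := r n.+1.
by exists (shiftw v); split=> //; [exact: shift_shiftw|exact/(lex_lt_shiftw _ _ a0)].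
Qed.

Lemma right_limit_iter k w : right_limit w -> right_limit (iter k shiftw w).
Proof. by move=> r; elim: k => //= k /right_limit_shiftw. Qed.

(** Otherwise one fixed letter other than [w 0] would precede words arbitrarily close to [shiftw w],
    and closedness of [L] would give [shiftw w] a second left extension. *)
Lemma left_extension_locally_constant w : L w -> ~ left_special (shiftw w) ->
  exists n, forall v, L v -> agree n (shiftw w) (shiftw v) -> v 0%N = w 0%N.
Proof.
move=> Lw nls; apply: contrapT => nex.
have [b hb] : exists b, forall n, exists v,
    [/\ L v, agree n (shiftw w) (shiftw v), v 0%N = b & b <> w 0%N].
  apply: ex_letter_forall => [a m n mn [v [? /(agree_le _ _ _ _ mn) ? ? ?]]|n].
    by exists v.
  apply: contrapT => h; apply: nex; exists n => v Lv a.
  by apply: contrapT => nv; apply: h; exists (v 0%N); exists v.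
have [_ [_ _ _ bw]] := hb 0%N.
apply: nls; exists b, (w 0%N); split=> //; last by rewrite consw_shiftw.
apply: shift_limit => n; have [v [Lv a v0 _]] := hb n; exists v; split=> //.
case=> [//|i] ni /=; have := a i; rewrite /shiftw => -> //; exact: ltnW.
Qed.

(** * Consequences of minimality and aperiodicity *)

Section Minimal.
Hypotheses (Lmin : minimal_shift L) (Lap : aperiodic L).

(** The image of the shift is nonempty, closed and invariant, so minimality makes it all of [L];
    closedness comes from a first letter that works at every length. *)
Lemma shiftw_surj w : L w -> exists2 v, L v & shiftw v = w.
Proof.
pose M := [set u | exists2 v, L v & shiftw v = u].
move=> Lw.
have ML : M `<=` L by move=> u [v Lv <-]; exact: shift_shiftw.
suff ME : M = L by rewrite -ME in Lw.
apply: Lmin => //.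
- by exists (shiftw w); exists w.
- apply/cantor_closedP => u h.
  have [b hb] : exists b, forall n, exists v,
      [/\ L v, agree n (shiftw v) u & v 0%N = b].
    apply: ex_letter_forall => [a m n mn [v [? /(agree_le _ _ _ _ mn) ? ?]]|n].
      by exists v.
    by have [_ [[v Lv <-] a]] := h n; exists (v 0%N); exists v.
  exists (consw b u) => //; apply: shift_limit => n.
  have [v [Lv a v0]] := hb n; exists v; split=> //.
  by case=> [//|i] ni /=; exact: (a i (ltnW ni)).
- by move=> u /ML Lu; exists u.
Qed.

Lemma backward_path w : L w -> exists y : nat -> nat -> A,
  [/\ y 0%N = w, forall i, L (y i) & forall i, shiftw (y i.+1) = y i].
Proof.
move=> Lw; have /choice[f hf] : forall u, exists v, L u -> L v /\ shiftw v = u.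
  move=> u; have [/shiftw_surj[v Lv vu]|nLu] := EM (L u); last by exists u.
  by exists v.
pose y i := iter i f w; have Ly i : L (y i).
  by elim: i => [//|i IH]; have [] := hf _ IH.
by exists y; split=> // i; have [] := hf _ (Ly i).
Qed.

(** The orbit of a periodic word is finite, hence closed, so minimality would make it equal to [L],
    against aperiodicity. *)
Lemma shift_no_period w p : L w -> (0 < p)%N -> iter p shiftw w <> w.
Proof.
move=> Lw p0 ewp; apply: Lap; exists w, p; split=> //.
have iterE k i : iter k shiftw w i = w (k + i)%N.
  by elim: k i => [//|k IH] i; rewrite iterS /shiftw IH addSnnS.
split=> [i|]; first by rewrite addnC -iterE ewp.
apply/esym; apply: Lmin.
- by move=> _ [k _ <-]; exact: shift_iter.
- by exists w; exists 0%N.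
- apply/cantor_closedP => v h.
  have modE k : iter k shiftw w = iter (k %% p) shiftw w.
    rewrite {1}(divn_eq k p) addnC iterD; congr (iter _ _ _).
    elim: (k %/ p)%N => [|q IH]; first by rewrite mul0n.
    by rewrite mulSn addnC iterD ewp.
  (* A limit of the finite orbit is approximated at every length by a single one of its [p]
     points. *)
  have [j hj] : exists j : 'I_p, forall n, agree n (iter j shiftw w) v.
    apply: contrapT => nex.
    have /choice[f hf] : forall j : 'I_p, exists n, ~ agree n (iter j shiftw w) v.
      move=> j; apply: contrapT => h'; apply: nex; exists j => n.
      by apply: contrapT => h''; apply: h'; exists n.
    have [_ [[k _ <-] a]] := h (\max_j f j)%N.
    apply: (hf (Ordinal (ltn_pmod k p0))) => /=; rewrite -modE.
    apply: agree_le a; exact: (leq_bigmax (Ordinal (ltn_pmod k p0))).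
  by exists j => //; exact: agree_eq.
- by move=> _ [k _ <-]; exists k.+1.
Qed.

Lemma iter_backward (y : nat -> nat -> A) : (forall i, shiftw (y i.+1) = y i) ->
  forall i j, iter i shiftw (y (j + i)%N) = y j.
Proof.
by move=> h i; elim: i => [|i IH] j; rewrite ?addn0 // iterSr addnS h IH.
Qed.

End Minimal.

(** * Factors as prefixes, and lower bounds on the complexity *)

Definition prefix_tuple n w : n.-tuple A := [tuple w i | i < n].

Lemma prefix_tupleP n v w : prefix_tuple n v = prefix_tuple n w <-> agree n v w.
Proof.
split=> [h i ni|h]; last by apply: eq_from_tnth => i; rewrite !tnth_mktuple h.
have := congr1 (fun t => tnth t (Ordinal ni)) h.
by rewrite !tnth_mktuple.
Qed.

Lemma Fact_prefix n w : L w -> Fact L n (prefix_tuple n w).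
Proof. by move=> Lw; exists w, 0%N; split=> // i; rewrite tnth_mktuple. Qed.

Lemma FactP n t : Fact L n t -> exists2 w, L w & t = prefix_tuple n w.
Proof.
move=> [w [k [Lw h]]]; exists (iter k shiftw w); first exact: shift_iter.
have iterE i : iter k shiftw w i = w (k + i)%N.
  by elim: k i {h} => [//|k IH] i; rewrite iterS /shiftw IH addSnnS.
by apply: eq_from_tnth => i; rewrite tnth_mktuple h iterE.
Qed.

Lemma complexity_ge (T : finType) (f : T -> (nat -> A)) n :
  (forall t, L (f t)) -> (forall t t', agree n (f t) (f t') -> t = t') ->
  (#|T| <= complexity L n)%N.
Proof.
move=> Lf finj; rewrite /complexity -(card_codom (f := fun t => prefix_tuple n (f t))).
  apply: subset_leq_card; apply/fintype.subsetP => _ /codomP[t ->].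
  by rewrite inE; apply/asboolP; exact: Fact_prefix.
by move=> t t' /prefix_tupleP /finj.
Qed.

(** * Finiteness results from linear complexity *)

Section LinearComplexity.
Hypotheses (L0 : L !=set0) (Lmin : minimal_shift L) (Lap : aperiodic L)
  (Llin : linear_complexity L).

(* Deleting the first letter maps the factors of length [n.+1] onto those of
   length [n], and prefixes of left special words have two preimages. *)
Lemma complexity_left_special (K : nat) (l : 'I_K -> (nat -> A)) n :
  (forall k, L (l k)) -> (forall k, left_special (l k)) ->
  (forall k k', agree n (l k) (l k') -> k = k') ->
  (complexity L n + K <= complexity L n.+1)%N.
Proof.
move=> Ll lsl linj; have [w0 _] := L0.
pose X := finset (fun t : n.-tuple A => `[< Fact L n t >]).
have /choice[c hc] : forall t : n.-tuple A, exists v, t \in X ->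
    L v /\ prefix_tuple n (shiftw v) = t.
  move=> t; have [|_] := boolP (t \in X); last by exists w0.
  rewrite inE => /asboolP /FactP[w Lw ->].
  by have [v Lv <-] := shiftw_surj Lmin w Lw; exists v.
have /choice[d hd] : forall k, exists v,
    [/\ L v, shiftw v = l k & v 0%N <> c (prefix_tuple n (l k)) 0%N].
  move=> k; have [a [b [ab La Lb]]] := lsl k.
  have [e|ne] := EM (a = c (prefix_tuple n (l k)) 0%N); last by exists (consw a (l k)).
  by exists (consw b (l k)); split=> //= h; apply: ab; rewrite h.
pose f (t : {t | t \in X} + 'I_K) := match t with inl t => c (val t) | inr k => d k end.
have <- : #|{: {t | t \in X} + 'I_K}| = (complexity L n + K)%N.
  by rewrite card_sum card_ord card_sig.
apply: (complexity_ge _ f) => [[[t tX]|k]|[[t tX]|k] [[t' tX']|k']] /=.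
- by have [] := hc t tX.
- by have [] := hd k.
- move=> /agreeS[_ /prefix_tupleP]; have [_ ->] := hc t tX; have [_ ->] := hc t' tX'.
  by move=> e; congr inl; exact: val_inj.
- move=> /agreeS[e0 /prefix_tupleP]; have [_ ->] := hc t tX.
  have [_ -> d0] := hd k' => e; case: d0; by rewrite -e -e0.
- move=> /agreeS[e0 /prefix_tupleP]; have [_ ->] := hc t' tX'.
  have [_ -> d0] := hd k => e; case: d0; by rewrite e e0.
- by move=> /agreeS[_]; have [_ -> _] := hd k; have [_ -> _] := hd k' => /linj ->.
Qed.

(** [C + 1] left special words, told apart by their prefixes of length [M], make the complexity grow
    by at least [C + 1] at each step beyond [M], which outruns the bound [C * n]. *)
Lemma finite_left_special : finite_set [set u | L u /\ left_special u].
Proof.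
have [C [N hC]] := Llin; apply: contrapT => /(infinite_set_fset C.+1).
move=> [s sub ss].
pose l (k : 'I_(size (finmap.enum_fset s))) := tnth (in_tuple (finmap.enum_fset s)) k.
have lS k : L (l k) /\ left_special (l k) by apply: sub; exact: mem_tnth.
have linj : injective l.
  move=> k k'; rewrite /l !(tnth_nth (l k)) /= => /eqP.
  by rewrite nth_uniq ?finmap.fset_uniq // => /eqP /val_inj.
have [M hM] : exists M, forall k k', agree M (l k) (l k') -> k = k'.
  have /choice[f hf] : forall kk : 'I_(size (finmap.enum_fset s)) * 'I_(size (finmap.enum_fset s)), exists M,
      agree M (l kk.1) (l kk.2) -> kk.1 = kk.2.
    move=> [k k'] /=; have [->|/eqP ne] := eqVneq k k'; first by exists 0%N.
    have /neq_agree[n [_ nn]] : l k <> l k' by move/linj.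
    by exists n.+1 => /(_ n (ltnSn n)).
  exists (\max_kk f kk)%N => k k' h; apply: (hf (k, k')).
  by apply: agree_le h; exact: (leq_bigmax (k, k')).
have grow i : (i * (size (finmap.enum_fset s)) <= complexity L (M + i))%N.
  elim: i => [//|i IH]; rewrite addnS mulSn addnC.
  apply: leq_trans (complexity_left_special _ l _ _ _ _); first by rewrite leq_add2r.
  - by move=> k; have [] := lS k.
  - by move=> k; have [] := lS k.
  - by move=> k k' h; apply: hM; apply: agree_le h; exact: leq_addr.
(* With [i = C * M + N + 1] steps, [(C + 1) * i] exceeds [C * (M + i)], and [M + i] is at least
   [N]. *)
have := leq_trans (grow (C * M + N).+1) (hC _ _).
rewrite addnS leqW ?addnA ?leq_addl // => /(_ isT).
apply/negP; rewrite -ltnNge -addnS mulnDr.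
apply: (@leq_trans ((C * M + N).+1 * C.+1)); last by rewrite leq_mul2l ss orbT.
by lia.
Qed.

(** The length is kept as a parameter because the counting below tracks its growth along backward
    orbits. *)
Definition left_isolated n w := L w /\ forall s, L s -> lex_lt s w -> ~ agree n s w.

Lemma left_isolated_le m n w : (m <= n)%N -> left_isolated m w -> left_isolated n w.
Proof. by move=> mn [Lw h]; split=> // s Ls sw /(agree_le _ _ _ _ mn); exact: h. Qed.

(** The shift preserves the order of words with the same first letter, so a smaller word too close
    to [y] would shift to one too close to [shiftw y]. *)
Lemma left_isolated_back n y : L y -> left_isolated n (shiftw y) -> left_isolated n.+1 y.
Proof.
move=> Ly [_ h]; split=> // s Ls sy /agreeS[s0 a].
by apply: h a; [exact: shift_shiftw|exact/(lex_lt_shiftw _ _ s0)].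
Qed.

Lemma left_isolated_agree n v w : left_isolated n v -> left_isolated n w ->
  agree n v w -> v = w.
Proof.
move=> [Lv hv] [Lw hw] a; apply: contrapT => /lex_total[vw|wv].
  exact: (hw v).
by apply: (hv w) => //; exact: agree_sym.
Qed.

Lemma left_isolated_orbits_bounded : exists C, forall (K : nat) (w : 'I_K -> (nat -> A)),
  (forall k, exists n, left_isolated n (w k)) ->
  (forall k k', orbit_equiv (w k) (w k') -> k = k') -> (K <= C)%N.
Proof.
have [C [N hC]] := Llin; exists C => K w /choice[m hm] winj.
have /choice[y hy] : forall k, exists y : nat -> nat -> A,
  [/\ y 0%N = w k, forall i, L (y i) & forall i, shiftw (y i.+1) = y i].
  by move=> k; apply: backward_path => //; have [] := hm k.
pose M := (\max_k m k)%N.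
have isoy k i : left_isolated (M + i) (y k i).
  have [y0 Ly yS] := hy k; elim: i => [|i IH].
    by rewrite addn0 y0; apply: left_isolated_le (hm k); exact: leq_bigmax.
  by rewrite addnS; apply: left_isolated_back; rewrite ?yS.
have yw k i : iter i shiftw (y k i) = w k.
  by have [<- _ /iter_backward h] := hy k; rewrite -(h i 0%N).
(* A common backward word makes the starting words orbit equivalent, so [k = k']; a coincidence
   inside one backward orbit would be a period. *)
have yinj k k' i i' : y k i = y k' i' -> k = k' /\ i = i'.
  move=> e; have ekk : k = k'.
    apply: winj; exists i', i.
    by rewrite -(yw k i) -(yw k' i') e -!iterD addnC.
  subst k'; split=> //; have [_ Ly /iter_backward h] := hy k.
  wlog lt : i i' e / (i < i')%N.
    by move=> hh; case: (ltngtP i i') => // lt; [|apply/esym]; apply: hh.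
  exfalso; apply: (shift_no_period Lmin Lap (y k i) (i' - i)) => //.
    by rewrite subn_gt0.
  by have := h (i' - i)%N i; rewrite subnKC ?(ltnW lt) // -e.
have bound n : (K * n <= complexity L (M + n))%N.
  have <- : #|{: 'I_K * 'I_n}| = (K * n)%N by rewrite card_prod !card_ord.
  apply: (complexity_ge _ (fun kn : 'I_K * 'I_n => y kn.1 kn.2)) => [[k i]|[k i] [k' i']] /=.
    by have [] := hy k.
  have iso j (q : 'I_n) : left_isolated (M + n) (y j q).
    by apply: left_isolated_le (isoy j q); rewrite leq_add2l ltnW.
  move=> /(left_isolated_agree _ _ _ (iso k i) (iso k' i')) /yinj[-> /val_inj ->].
  by [].
rewrite leqNgt; apply/negP => CK.
have := leq_trans (bound (C * M + N).+1) (hC _ _).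
rewrite addnS leqW ?addnA ?leq_addl // => /(_ isT).
apply/negP; rewrite -ltnNge -addnS mulnDr.
apply: (@leq_trans (C.+1 * (C * M + N).+1)); last by rewrite leq_mul2r CK orbT.
by lia.
Qed.

(** The bound provides a family of pairwise inequivalent left isolated words of maximal size; a left
    isolated word equivalent to none of them would enlarge it. *)
Lemma left_isolated_orbits : exists (K : nat) (w : 'I_K -> (nat -> A)),
  (forall k, exists n, left_isolated n (w k)) /\
  forall v n, left_isolated n v -> exists k, orbit_equiv v (w k).
Proof.
have [C hC] := left_isolated_orbits_bounded.
pose P K := `[< exists w : 'I_K -> (nat -> A),
  (forall k, exists n, left_isolated n (w k)) /\
  (forall k k', orbit_equiv (w k) (w k') -> k = k') >].
have P0 : exists K, P K.
  have [w0 _] := L0; exists 0%N; apply/asboolP; exists (fun=> w0).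
  by split=> -[].
have PC K : P K -> (K <= C)%N by move=> /asboolP[w [h1 h2]]; exact: hC h2.
case: (ex_maxnP P0 PC) => K /asboolP[w [wiso winj]] Kmax.
exists K, w; split=> // v n viso; apply: contrapT => nex.
suff /Kmax : P K.+1 by rewrite ltnn.
apply/asboolP; exists (fun k => if unlift ord0 k is Some j then w j else v).
have eqs u u' : orbit_equiv u u' -> orbit_equiv u' u by move=> [i [j e]]; exists j, i.
split=> [k|k k'].
  by case: (unliftP ord0 k) => [j|] _ //; exists n.
case: (unliftP ord0 k) => [j ->|->]; case: (unliftP ord0 k') => [j' ->|->] //.
- by move=> /winj ->.
- by move=> /eqs h; case: nex; exists j.
- by move=> h; case: nex; exists j'.
Qed.

End LinearComplexity.
End Shifts.

(** * Maps that are locally translations *)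

Section PiecewiseTranslations.
Context {R : realType}.
Implicit Types (T g : R -> R) (x y z a b c e : R).

(** Connectedness: the supremum of the points up to which [g] keeps the value [g y] cannot stay
    below [z], since local constancy at the supremum pushes it further. *)
Lemma locally_constant_itv g a b :
  (forall z, a < z < b -> exists2 e, 0 < e &
    forall y, a < y < b -> `|y - z| < e -> g y = g z) ->
  forall y z, a < y < b -> a < z < b -> g y = g z.
Proof.
move=> loc y z; wlog yz : y z / y <= z.
  by move=> h yab zab; case: (leP y z) => [|/ltW] yz; [|apply/esym]; exact: h.
move=> /andP[ay yb] /andP[az zb].
pose S := [set t | y <= t <= z /\ forall s, y <= s <= t -> g s = g y].
have Sy : S y.
  split; first by rewrite lexx yz.
  by move=> s; rewrite -eq_le => /eqP ->.
have supS : has_sup S by split; [exists y|exists z => t [/andP[]]].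
set t := sup S; have yt : y <= t by exact: sup_upper_bound.
have tz : t <= z by apply: ge_sup; [exists y|move=> s [/andP[]]].
have [|e e0 he] := loc t; first by lra.
have [s [/andP[ys sz] hs] ts] := sup_adherent e0 supS.
have st : s <= t by apply: sup_upper_bound => //; split=> //; rewrite ys.
have gt : g t = g y.
  rewrite -(hs s) ?ys ?lexx //; apply/esym/he; first by lra.
  by rewrite ltr_norml; rewrite -/t in ts; lra.
have Su u : t <= u <= z -> u < t + e -> S u.
  move=> /andP[tu uz] ute; split=> [|v /andP[yv vu]]; first lra.
  have [vs|sv] := leP v s; first by apply: hs; rewrite yv vs.
  rewrite -gt; apply: he; first by lra.
  by rewrite ltr_norml; rewrite -/t in ts; lra.
have [zt|tz'] := leP z t; first by apply/esym; have -> : z = t by apply/eqP; rewrite eq_le zt.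
pose u := Num.min z (t + e / 2).
have tu : t < u by rewrite lt_min tz'; lra.
have : u <= t.
  apply: sup_upper_bound => //; apply: Su.
    by rewrite (ltW tu) ge_min lexx.
  by rewrite gt_min; apply/orP; right; lra.
lra.
Qed.

Lemma finite_set_isolated (F : set R) z : finite_set F ->
  exists2 e, 0 < e & forall y, F y -> `|y - z| < e -> y = z.
Proof.
move=> /finite_seqP[s ->]; elim: s => [|p s [e e0 IH]]; first by exists 1.
have [->|pz] := eqVneq p z.
  by exists e => // y /=; rewrite inE => /orP[/eqP//|]; exact: IH.
exists (Num.min e `|p - z|); first by rewrite lt_min e0 normr_gt0 subr_eq0.
move=> y /=; rewrite inE lt_min => /orP[/eqP ->|ys /andP[ye _]]; last exact: IH.
by rewrite ltxx andbF.
Qed.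

Lemma contI_translation T a b c y : (forall u, inI u -> a < u < b -> T u = u + c) ->
  inI y -> a < y < b -> contI T y.
Proof.
move=> h Iy yab e e0; exists (Num.min e (Num.min (y - a) (b - y))).
split=> [|u Iu]; first by rewrite !lt_min e0 /=; lra.
rewrite !lt_min => /andP[ue]; rewrite !ltr_norml => hab.
move: ue; rewrite ltr_norml => ue.
have [-> ->] : T u = u + c /\ T y = y + c by split; apply: h => //; lra.
by lra.
Qed.

Lemma ex_lt_both a b : 0 < a -> 0 < b -> exists t, [/\ 0 < t, t < a & t < b].
Proof.
move=> a0 b0; exists (Num.min a b / 2).
have [ab|ba] := leP a b; split; lra.
Qed.

(** An error [d] at [z] is impossible: for small [t < d / 2], the value at [z - t] is within [d / 2]
    of [T z] and at distance [t] from [z + c]. *)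
Lemma contI_left_translation T z c e : contI T z -> 0 < z < 1 -> 0 < e ->
  (forall y, inI y -> z - e < y < z -> T y = y + c) -> T z = z + c.
Proof.
move=> Tz z01 e0 h; apply/eqP; rewrite -subr_eq0; apply/negPn/negP => nz.
pose d := `|T z - (z + c)|; have d0 : 0 < d by rewrite normr_gt0.
have [|r [r0 hr]] := Tz (d / 2); first by lra.
have z0 : 0 < z by lra.
have [t1 [t10 t1e t1z]] := ex_lt_both _ _ e0 z0.
have [t2 [t20 t2r t2d]] := ex_lt_both r (d / 2) r0 (ltac:(lra)).
have [t [t0 tt1 tt2]] := ex_lt_both _ _ t10 t20.
have It : inI (z - t) by rewrite /inI; lra.
have := hr (z - t) It; rewrite h //; last by lra.
rewrite addrAC subrr add0r normrN gtr0_norm // => /(_ (lt_trans tt2 t2r)) lt_d.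
have : d <= `|z - t + c - T z| + t.
  rewrite /d -{2}(gtr0_norm t0) distrC (le_trans _ (ler_normD _ _)) //.
  by rewrite le_eqVlt; apply/orP; left; apply/eqP; congr `|_|; ring.
by lra.
Qed.

Lemma right_continuous_translation T x x' c : right_continuous_I T -> inI x ->
  x < x' -> x' <= 1 -> (forall y, x < y < x' -> T y = y + c) -> T x = x + c.
Proof.
move=> Tx Ix xx' x'1 h; apply/eqP; rewrite -subr_eq0; apply/negPn/negP => nz.
pose d := `|T x - (x + c)|; have d0 : 0 < d by rewrite normr_gt0.
have [|r [r0 hr]] := Tx x Ix (d / 2); first by lra.
have [t2 [t20 t2r t2d]] := ex_lt_both r (d / 2) r0 (ltac:(lra)).
have [t [t0 tt1 tt2]] := ex_lt_both (x' - x) _ (ltac:(lra)) t20.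
move: (Ix); rewrite /inI => Ix'.
have It : inI (x + t) by rewrite /inI; lra.
have := hr (x + t) It; rewrite h; last by lra.
move=> /(_ (ltac:(lra))) lt_d.
have : d <= `|x + t + c - T x| + t.
  rewrite /d -{2}(gtr0_norm t0) distrC -[`|t|]normrN (le_trans _ (ler_normD _ _)) //.
  by rewrite le_eqVlt; apply/orP; left; apply/eqP; congr `|_|; ring.
by lra.
Qed.

Lemma increasing_nat_lt m (xs : nat -> R) : (forall i, (i < m)%N -> xs i < xs i.+1) ->
  forall i j, (i < j)%N -> (j <= m)%N -> xs i < xs j.
Proof.
move=> h i; elim=> // j IH; rewrite ltnS leq_eqVlt => /orP[/eqP ->|ij] jm; first exact: h.
exact: lt_trans (IH ij (ltnW jm)) (h _ jm).
Qed.

(** Induction on [s]: a new point matters only if it is interior to a current cell, which it then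
    splits in two. *)
Lemma finite_partition (s : seq R) : exists (m : nat) (xs : nat -> R),
  [/\ xs 0%N = 0, xs m = 1, (forall i, (i < m)%N -> xs i < xs i.+1),
      (forall i, (i <= m)%N -> 0 <= xs i <= 1) &
      (forall i p, (i < m)%N -> p \in s -> ~~ (xs i < p < xs i.+1))].
Proof.
elim: s => [|p s [m [xs [xs0 xsm xslt xs01 xsP]]]].
  exists 1%N, (fun i => i%:R); split=> //.
  - by case=> // _; rewrite ltr01.
  - by case=> [|[|//]] _; rewrite ?lexx ?ler01.
have [[i [im /andP[xip pxi]]]|nex] := EM (exists i, (i < m)%N /\ xs i < p < xs i.+1);
  last first.
  exists m, xs; split=> // i q im; rewrite inE => /orP[/eqP ->|]; last exact: xsP.
  by apply/negP => h; apply: nex; exists i.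
(* The new node [p] gets index [i.+1], and the later nodes move up by one. *)
pose ys j := if (j <= i)%N then xs j else if j == i.+1 then p else xs j.-1.
have ysl j : (j <= i)%N -> ys j = xs j by rewrite /ys => ->.
have ysm : ys i.+1 = p by rewrite /ys ltnn eqxx.
have ysr j : (i.+1 < j)%N -> ys j = xs j.-1.
  by move=> ij; rewrite /ys leqNgt (ltnW ij) /= gtn_eqF.
have ysS j : (j < m.+1)%N -> ys j < ys j.+1.
  rewrite ltnS => jm; case: (ltngtP j i) => [ji|ij|->].
  - rewrite !ysl ?(ltnW ji) //; exact: xslt (ltn_trans ji im).
  - case: (ltngtP j i.+1) ij => // [ij _|-> _]; last by rewrite ysm ysr.
    rewrite !ysr ?(ltnW (ltn_trans ij (ltnSn _))) //; last exact: ltnW.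
    by case: j ij jm => // j ij jm; exact: xslt.
  - by rewrite ysm ysl.
exists m.+1, ys; split.
- by rewrite ysl.
- by rewrite ysr.
- exact: ysS.
- move=> j jm; case: (leqP j i) => ji; first by rewrite ysl // xs01 // (leq_trans ji) // ltnW.
  case: (ltngtP j i.+1) ji => // [ij _|-> _]; first by rewrite ysr // xs01 //; case: j ij jm.
  rewrite ysm; have := xs01 i (ltnW im); have := xs01 i.+1 im; lra.
- move=> j q jm; rewrite inE => /orP[/eqP ->|qs].
    apply/negP; rewrite -ysm => /andP[h1 h2].
    have [ji|ij] := leqP i.+1 j.
      have : ys i.+1 <= ys j; last by rewrite leNgt h1.
      move: ji; rewrite leq_eqVlt => /orP[/eqP -> //|ji]; apply/ltW.
      by apply: (increasing_nat_lt m.+1) => //; exact: ltnW.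
    have : ys j.+1 <= ys i.+1; last by rewrite leNgt h2.
    move: ij; rewrite leq_eqVlt => /orP[/eqP -> //|ij]; apply/ltW.
    by apply: (increasing_nat_lt m.+1) => //; rewrite ltnS ltnW.
  apply/negP => /andP[h1 h2]; case: (ltngtP j i) => [ji|ij|e].
  + move: h1 h2; rewrite !ysl ?(ltnW ji) // => h1 h2.
    by have /negP := xsP j q (ltn_trans ji im) qs; rewrite h1 h2.
  + case: (ltngtP j i.+1) ij => // [ij _|e _].
      move: h1 h2; rewrite !ysr ?(ltnW (ltn_trans ij (ltnSn _))) //; last exact: ltnW.
      case: j ij jm => // j ij jm /= h1 h2.
      by have /negP := xsP j q jm qs; rewrite h1 h2.
    move: h1 h2; rewrite e ysm ysr //= => h1 h2.
    by have /negP := xsP i q im qs; rewrite h2 (lt_trans xip).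
  + move: h1 h2; rewrite e ysm ysl // => h1 h2.
    by have /negP := xsP i q im qs; rewrite h1 (lt_trans h2).
Qed.

End PiecewiseTranslations.

(** * The measure and the induced interval map *)

(** The dual order [A^d] exchanges successors with predecessors. *)
Lemma min_gap_or_left_limit {dA : Order.disp_t} {A : finOrderType dA}
    (L : set (nat -> A)) (w : nat -> A) : is_shift L -> L w ->
  [\/ forall v, L v -> lex_le w v, exists w', gap L w' w | left_limit L w].
Proof.
move=> Lsh Lw.
have ltE (v u : nat -> A) : @lex_lt _ A^d v u <-> lex_lt u v.
  by split=> -[n [h hn]]; exists n; split=> // i /h.
have leE (v u : nat -> A) : @lex_le _ A^d v u <-> lex_le u v.
  by split=> -[->|/ltE h]; [left|right|left|right].
case: (@max_gap_or_right_limit _ A^d L Lsh w Lw) => [h|[w' [_ Lw' ww' h]]|h].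
- by constructor 1 => v /h /leE.
- constructor 2; exists w'; split=> //; first exact/ltE.
  move=> v Lv w'v; apply/lex_leP => vw.
  by have /leE/lex_leP := h v Lv (proj2 (ltE _ _) vw).
- by constructor 3 => n; have [v [Lv /ltE ? ?]] := h n; exists v.
Qed.

Section CantorTopology.
Context {dA : Order.disp_t} {A : finOrderType dA}.
Implicit Types (v w : nat -> A).

Lemma cantor_open_gt w : cantor_open [set v | lex_lt w v].
Proof. by move=> v /lex_lt_open[n h]; exists n => v' a; exact: h. Qed.

Lemma cantor_open_cylinder n w : cantor_open [set v | agree n w v].
Proof.
by move=> v a; exists n => v' a'; apply: agree_trans a _; exact: agree_sym.
Qed.

End CantorTopology.

Section InvariantMeasure.
Context {R : realType} {dA : Order.disp_t} {A : finOrderType dA} {a0 : A}.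
Variables (L : set (nat -> A)) (mu : probability (Wmeas a0) R).
Hypotheses (Lsh : is_shift L) (Lmin : minimal_shift L) (Lap : aperiodic L)
  (muL : mu L = 1%E)
  (mu_inv : forall B : set (Wmeas a0), measurable B -> mu (shiftw @^-1` B) = mu B).
Implicit Types (u v w s : nat -> A) (B : set (Wmeas a0)).

Local Notation phi_mu := (phi_mu L mu).

Definition mass (B : set (Wmeas a0)) : R := fine (mu B).

Lemma measurable_cantor_open B : cantor_open B -> measurable B.
Proof. exact: sub_sigma_algebra. Qed.

Lemma measurable_cantor_closed B : cantor_closed B -> measurable B.
Proof. by move=> /measurable_cantor_open; rewrite -{2}(setCK B); exact: measurableC. Qed.

Lemma measurable_shift : measurable (L : set (Wmeas a0)).
Proof. by apply: measurable_cantor_closed; case: Lsh. Qed.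

Lemma measurable_lex_le w : measurable ([set v | L v /\ lex_le v w] : set (Wmeas a0)).
Proof.
apply: measurableI; first exact: measurable_shift.
rewrite -[X in measurable X]setCK; apply: measurableC.
apply: measurable_cantor_open => v h; have /lex_ltP wv := h.
have [n hn] := cantor_open_gt _ _ wv; exists n => v' /hn /lex_ltP; exact.
Qed.

(** Open on the left, so that for [v] below [w] its mass is the increment of [phi_mu]. *)
Definition lex_itv v w : set (Wmeas a0) := [set s | [/\ L s, lex_lt v s & lex_le s w]].

Lemma measurable_lex_itv v w : measurable (lex_itv v w).
Proof.
have -> : lex_itv v w = [set s | L s /\ lex_le s w] `\` [set s | L s /\ lex_le s v].
  apply/seteqP; split=> s /=.
    by move=> [Ls /lex_ltP vs sw]; split=> // -[].
  by move=> [[Ls sw] nsv]; split=> //; apply/lex_ltP => sv; exact: nsv.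
by apply: measurableD; exact: measurable_lex_le.
Qed.

Lemma fin_mass B : measurable B -> (mass B)%:E = mu B.
Proof. by move=> mB; rewrite /mass fineK // fin_num_measure. Qed.

Lemma mass_ge0 B : 0 <= mass B.
Proof. exact: fine_ge0. Qed.

Lemma mass_le B B' : measurable B -> measurable B' -> B `<=` B' -> mass B <= mass B'.
Proof.
by move=> mB mB' BB'; rewrite -lee_fin !fin_mass //; apply: le_measure; rewrite ?inE.
Qed.

Lemma massU B B' : measurable B -> measurable B' -> B `&` B' = set0 ->
  mass (B `|` B') = mass B + mass B'.
Proof.
move=> mB mB' BB'; apply/eqP; rewrite -eqe EFinD !fin_mass //; last exact: measurableU.
by apply/eqP; exact: measureU.
Qed.

Lemma mass_shift : mass L = 1.
Proof. by rewrite /mass muL. Qed.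

Lemma mass_le1 B : measurable B -> mass B <= 1.
Proof. by move=> mB; rewrite -lee_fin fin_mass //; exact: probability_le1. Qed.

(** [L] has full mass, so its complement is null. *)
Lemma mass_setIL B : measurable B -> mass (L `&` B) = mass B.
Proof.
have mL := measurable_shift; move=> mB.
have mI : measurable (L `&` B : set (Wmeas a0)) by exact: measurableI.
have mD : measurable (B `\` L : set (Wmeas a0)) by exact: measurableD.
have : mass (L `|` (B `\` L)) <= 1 by apply: mass_le1; exact: measurableU.
rewrite massU //; last by apply/seteqP; split=> s //= [? []].
rewrite mass_shift => h.
have -> : mass B = mass ((L `&` B) `|` (B `\` L)).
  congr mass; apply/seteqP; split=> s /=; last by case=> -[].
  by have [Ls|nLs] := EM (L s); [left|right].
rewrite massU //; last by apply/seteqP; split=> s //= [[? ?] []].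
by have := mass_ge0 (B `\` L); lra.
Qed.

Lemma shiftw_measurable B : measurable B ->
  measurable (shiftw @^-1` B : set (Wmeas a0)).
Proof.
(* The sets with measurable preimage form a sigma-algebra, which contains the open sets because the
   shift is continuous. *)
pose G := [set B : set (Wmeas a0) | measurable (shiftw @^-1` B : set (Wmeas a0))].
move=> mB; suff : G B by []; apply: mB; split; last first.
  move=> U oU; apply: measurable_cantor_open => v /oU[n hn].
  by exists n.+1 => v' h; apply: hn => i ni; exact: h.
split.
- by rewrite /G /= preimage_set0.
- by move=> B' GB'; rewrite /G /= setTD preimage_setC; exact: measurableC.
- by move=> F GF; rewrite /G /= preimage_bigcup; apply: bigcup_measurable => k _; exact: GF.
Qed.

Lemma mass_shiftw B : measurable B -> mass (shiftw @^-1` B) = mass B.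
Proof. by move=> mB; rewrite /mass mu_inv. Qed.

Lemma iter_shiftw_measurable k B : measurable B ->
  measurable (iter k shiftw @^-1` B : set (Wmeas a0)) /\ mass (iter k shiftw @^-1` B) = mass B.
Proof.
move=> mB; elim: k => [//|k [mk ek]].
have -> : iter k.+1 shiftw @^-1` B = shiftw @^-1` (iter k shiftw @^-1` B).
  by apply/seteqP; split=> s; rewrite /preimage /= -iterS iterSr.
by split; [exact: shiftw_measurable|rewrite mass_shiftw].
Qed.

(** * Full support and absence of atoms *)

Lemma shift_nonempty : L !=set0.
Proof.
apply: contrapT => /set0P/negP; rewrite negbK => /eqP e.
by move: muL; rewrite e measure0 => /eqP; rewrite eqe eq_sym oner_eq0.
Qed.

(* The words of [L] that never visit the cylinder form a closed invariant set,
   which is empty by minimality, so the preimages of the cylinder cover [L]. *)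
Lemma cylinder_mass_gt0 n w : L w -> 0 < mass (L `&` [set v | agree n w v]).
Proof.
move=> Lw; rewrite lt_def mass_ge0 andbT; apply/eqP => e0.
pose U : set (Wmeas a0) := L `&` [set v | agree n w v].
have mU : measurable U.
  apply: measurableI; first exact: measurable_shift.
  by apply: measurable_cantor_open; exact: cantor_open_cylinder.
have cover : L `<=` \bigcup_k (iter k shiftw @^-1` U).
  move=> v Lv; apply: contrapT => nv.
  pose M := [set v | L v /\ forall k, ~ agree n w (iter k shiftw v)].
  have ML : M = L.
    apply: Lmin.
    - by move=> ? [].
    - exists v; split=> // k a; apply: nv; exists k => //; split=> //; exact: shift_iter.
    - apply/cantor_closedP => u h; split.
        by apply: (shift_limit L) => // m; have [u' [[]]] := h m; exists u'.
      move=> k a; have [u' [[_ /(_ k) nu'] a']] := h (k + n)%N; apply: nu'.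
      have iterE (s : nat -> A) i : iter k shiftw s i = s (k + i)%N.
        by elim: k i {a a' h} => [//|k IH] i; rewrite iterS /shiftw IH addSnnS.
      by move=> i ni; rewrite a // !iterE a' // ltn_add2l.
    - move=> u [Lu hu]; split; first exact: shift_shiftw.
      by move=> k; rewrite -iterSr; exact: hu.
  by have := Lw; rewrite -ML => -[_ /(_ 0%N)]; apply.
have negl : mu.-negligible (\bigcup_k (iter k shiftw @^-1` U)).
  apply: negligible_bigcup => k; have [mk ek] := iter_shiftw_measurable k _ mU.
  apply/negligibleP => //; suff : mu (iter k shiftw @^-1` U) = 0%E by [].
  by rewrite -fin_mass // ek e0.
have mb : measurable (\bigcup_k (iter k shiftw @^-1` U) : set (Wmeas a0)).
  by apply: bigcup_measurable => k _; have [] := iter_shiftw_measurable k _ mU.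
have := mass_le _ _ measurable_shift mb cover; rewrite mass_shift => h.
have : mass (\bigcup_k (iter k shiftw @^-1` U)) = 0.
  by rewrite /mass (measure_negligible mb negl).
by lra.
Qed.

Lemma measurable_word w : measurable ([set w] : set (Wmeas a0)).
Proof.
apply: measurable_cantor_closed; apply/cantor_closedP => v h.
by apply: agree_eq => n; have [_ [-> /agree_sym]] := h n.
Qed.

(* The preimages of a non-periodic word under the iterates of the shift are
   pairwise disjoint and have equal mass. *)
Lemma mass_word w : L w -> mass [set w] = 0.
Proof.
move=> Lw; pose c := mass [set w].
pose W k : set (Wmeas a0) := [set v | exists2 i, (i < k)%N & iter i shiftw v = w].
have mW k : measurable (W k) /\ mass (W k) = c *+ k.
  elim: k => [|k [mk ek]].
    have -> : W 0%N = set0 by apply/seteqP; split=> // v [].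
    by split=> //; rewrite /mass measure0.
  have [mV eV] := iter_shiftw_measurable k _ (measurable_word w).
  have -> : W k.+1 = W k `|` (iter k shiftw @^-1` [set w]).
    apply/seteqP; split=> v /=.
      by move=> [i]; rewrite ltnS leq_eqVlt => /orP[/eqP -> ?|ik ?]; [right|left; exists i].
    by move=> [[i ik e]|e]; [exists i => //; exact: ltnW|exists k].
  split; first exact: measurableU.
  rewrite massU // ?ek ?eV ?mulrSr //; apply/seteqP; split=> // v [[i ik e1] e2].
  apply: (shift_no_period L Lsh Lmin Lap w (k - i)) => //; first by rewrite subn_gt0.
  by rewrite -{1}e1 -iterD subnK // ltnW.
apply/eqP; rewrite eq_le mass_ge0 andbT leNgt; apply/negP => c0.
have := archi_boundP (ltW (_ : 0 < c^-1)); rewrite invr_gt0 => /(_ c0).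
set k := Num.Def.archi_bound _; rewrite -(ltr_pM2r c0) mulVf ?gt_eqF // mulr_natl.
by have [mk <-] := mW k; rewrite ltNge mass_le1.
Qed.

(** The cylinders around [w] decrease to [[set w]], which is null, and the measure is continuous
    from above. *)
Lemma small_cylinder w e : L w -> 0 < e ->
  exists n, mass (L `&` [set v | agree n w v]) < e.
Proof.
move=> Lw e0; pose F n : set (Wmeas a0) := L `&` [set v | agree n w v].
have mF n : measurable (F n).
  apply: measurableI; first exact: measurable_shift.
  by apply: measurable_cantor_open; exact: cantor_open_cylinder.
have FE : \bigcap_n F n = [set w].
  apply/seteqP; split=> [v h|_ -> n _]; last by split.
  by apply/esym; apply: agree_eq => n; have [] := h n I.
have /fine_cvgP[_] : mu (F n) @[n --> \oo] --> (0:R)%:E.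
  rewrite -(mass_word w Lw) fin_mass; last exact: measurable_word.
  rewrite -FE; apply: nonincreasing_cvg_mu => //.
  - suff : (mu (F 0%N) < +oo)%E by [].
    by rewrite -fin_mass // ltry.
  - by rewrite FE; exact: measurable_word.
  - by move=> m n mn; apply/subsetPset => v [Lv a]; split=> //; exact: agree_le a.
move=> /cvgrPdist_lt /(_ e e0)[n _ /(_ n (leqnn n))] /=.
rewrite sub0r normrN => h; exists n; exact: le_lt_trans (ler_norm _) h.
Qed.

(** An isolated word would be alone in a cylinder of positive mass, whereas single words are
    null. *)
Lemma not_isolated n w : L w -> exists v, [/\ L v, v <> w & agree n w v].
Proof.
move=> Lw; apply: contrapT => nex.
have := cylinder_mass_gt0 n w Lw.
have -> : L `&` [set v | agree n w v] = [set w].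
  apply/seteqP; split=> [v [Lv a]|_ ->] //=; apply: contrapT => ne.
  by apply: nex; exists v.
by rewrite mass_word // ltxx.
Qed.

Lemma right_or_left_limit w : L w -> ~ left_limit L w -> right_limit L w.
Proof.
move=> Lw nl; have [n0 h0] : exists n, forall v, L v -> lex_lt v w -> ~ agree n w v.
  apply: contrapT => h; apply: nl => n; apply: contrapT => h'; apply: h.
  by exists n => v Lv wv a; apply: h'; exists v.
move=> n; have [v [Lv vw a]] := not_isolated (maxn n n0) w Lw.
exists v; split=> //; last by apply: agree_le a; exact: leq_maxl.
have [vw'|//] := lex_total _ _ vw; exfalso; apply: (h0 v) => //.
by apply: agree_le a; exact: leq_maxr.
Qed.

Lemma gap_right_limit v w : gap L v w -> right_limit L w.
Proof.
move=> g; apply: right_or_left_limit; first by case: g.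
exact: gap_not_left_limit g.
Qed.

Lemma gap_left_limit v w : gap L v w -> left_limit L v.
Proof.
move=> g; apply: contrapT => /right_or_left_limit h.
by apply: (gap_not_right_limit L v w g); apply: h; case: g.
Qed.

(** * The distribution function [phi_mu] *)

Lemma phi_mu_le v w : lex_le v w -> phi_mu v <= phi_mu w.
Proof.
move=> vw; apply: mass_le; try exact: measurable_lex_le.
by move=> s /= [Ls sv]; split=> //; exact: lex_le_trans vw.
Qed.

Lemma phi_mu_sub v w : lex_le v w -> phi_mu w - phi_mu v = mass (lex_itv v w).
Proof.
move=> vw; suff -> : phi_mu w = phi_mu v + mass (lex_itv v w) by ring.
rewrite -massU; [congr mass|exact: measurable_lex_le|exact: measurable_lex_itv|].
  apply/seteqP; split=> s /=.
    move=> [Ls sw]; have [sv|/lex_ltP vs] := EM (lex_le s v); first by left.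
    by right.
  by move=> [[Ls sv]|[Ls _ sw]]; split=> //; exact: lex_le_trans vw.
by apply/seteqP; split=> s //= [[_ /lex_leP h] []].
Qed.

Lemma phi_mu_ge0 w : 0 <= phi_mu w.
Proof. exact: mass_ge0. Qed.

Lemma phi_mu_le1 w : phi_mu w <= 1.
Proof. apply: mass_le1; exact: measurable_lex_le. Qed.

(** A cylinder around [s] fits between [v] and [w] and has positive mass. *)
Lemma phi_mu_lt v s w : L s -> lex_lt v s -> lex_lt s w -> phi_mu v < phi_mu w.
Proof.
move=> Ls vs sw; rewrite -subr_gt0 phi_mu_sub; last by right; exact: lex_lt_trans sw.
have [n1 h1] := lex_lt_open _ _ vs; have [n2 h2] := lex_lt_open _ _ sw.
apply: lt_le_trans (cylinder_mass_gt0 (maxn n1 n2) s Ls) _.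
apply: mass_le; [|exact: measurable_lex_itv|].
  apply: measurableI; first exact: measurable_shift.
  by apply: measurable_cantor_open; exact: cantor_open_cylinder.
move=> u [Lu /agree_sym a]; split=> //.
  by apply: h1 => //; apply: agree_le a; exact: leq_maxl.
by right; apply: h2 => //; apply: agree_le a; exact: leq_maxr.
Qed.

Lemma phi_mu_gap v w : gap L v w -> phi_mu v = phi_mu w.
Proof.
move=> [Lv Lw vw h]; apply/esym/eqP; rewrite -subr_eq0 phi_mu_sub; last by right.
rewrite (_ : lex_itv v w = [set w]) ?mass_word //.
apply/seteqP; split=> [s [Ls vs sw]|_ ->]; last by split=> //; left.
by apply: lex_le_anti sw _; exact: h.
Qed.

Lemma phi_mu_eq_gap v w : L v -> L w -> lex_lt v w -> phi_mu v = phi_mu w -> gap L v w.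
Proof.
move=> Lv Lw vw e; split=> // s Ls vs; apply/lex_leP => sw.
by have := phi_mu_lt v s w Ls vs sw; rewrite e ltxx.
Qed.

Lemma phi_mu_lt_lex v w : phi_mu v < phi_mu w -> lex_lt v w.
Proof. by move=> h; apply/lex_ltP => /phi_mu_le; rewrite leNgt h. Qed.

Lemma phi_mu_right_limit v w : right_limit L v -> lex_lt v w -> phi_mu v < phi_mu w.
Proof.
move=> r vw; have [n h] := lex_lt_open _ _ vw; have [s [Ls vs /agree_sym a]] := r n.
by apply: (phi_mu_lt v s w) => //; exact: h.
Qed.

Lemma phi_mu_left_limit v w : left_limit L w -> lex_lt v w -> phi_mu v < phi_mu w.
Proof.
move=> r vw; have [n h] := lex_lt_open _ _ vw; have [s [Ls vs /agree_sym a]] := r n.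
by apply: (phi_mu_lt v s w) => //; exact: h.
Qed.

Lemma phi_mu_right_inj v w : right_limit L v -> right_limit L w ->
  phi_mu v = phi_mu w -> v = w.
Proof.
move=> rv rw e; apply: contrapT => /lex_total[/(phi_mu_right_limit _ _ rv)|].
  by rewrite e ltxx.
by move=> /(phi_mu_right_limit _ _ rw); rewrite e ltxx.
Qed.

(** The increment of [phi_mu] between two words of a cylinder is at most the mass of the
    cylinder. *)
Lemma phi_mu_cont w e : L w -> 0 < e -> exists n, forall v, L v -> agree n w v ->
  `|phi_mu v - phi_mu w| < e.
Proof.
move=> Lw e0; have [n hn] := small_cylinder w e Lw e0; exists n.
have key v u : L v -> L u -> lex_le v u -> agree n w v -> agree n w u ->
    `|phi_mu u - phi_mu v| < e.
  move=> Lv Lu vu av au.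
  rewrite ger0_norm ?subr_ge0 ?phi_mu_le // phi_mu_sub //.
  apply: le_lt_trans hn; apply: mass_le; first exact: measurable_lex_itv.
    apply: measurableI; first exact: measurable_shift.
    by apply: measurable_cantor_open; exact: cantor_open_cylinder.
  move=> s [Ls vs su]; split=> //; apply: (agree_trans _ _ v) => //.
  apply: (lex_agree_between n v s u) => //; first by right.
  exact: agree_trans (agree_sym _ _ _ av) au.
move=> v Lv a; have [vw|wv] := lex_le_total v w; last exact: key.
by rewrite distrC; exact: key.
Qed.

Lemma phi_mu_min w : L w -> (forall v, L v -> lex_le w v) -> phi_mu w = 0.
Proof.
move=> Lw h; rewrite -(mass_word w Lw); congr mass; apply/seteqP; split=> [s|_ ->].
  by move=> [Ls sw]; apply: lex_le_anti sw _; exact: h.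
by split=> //; left.
Qed.

Lemma phi_mu_max w : (forall v, L v -> lex_le v w) -> phi_mu w = 1.
Proof.
move=> h; rewrite -mass_shift; congr mass; apply/seteqP; split=> [s []//|s Ls].
by split=> //; exact: h.
Qed.

(** The largest word with value at most [x] attains [x]. If its value were smaller, it would not be
    the maximum of [L], whose value is 1; then its successor, which has the same value, or a close
    larger word would still have value at most [x]. *)
Lemma phi_mu_surj x : 0 <= x <= 1 -> exists2 w, L w & phi_mu w = x.
Proof.
move=> /andP[x0 x1]; pose F := [set v | L v /\ phi_mu v <= x].
have Lc : cantor_closed L by case: Lsh.
have Fc : cantor_closed F.
  apply/cantor_closedP => v h; have Lv : L v.
    by apply: (shift_limit L) => // k; have [v' [[Lv' _] a]] := h k; exists v'.
  split=> //; rewrite leNgt; apply/negP => xv.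
  have [n hn] := phi_mu_cont v (phi_mu v - x) Lv (ltac:(by rewrite subr_gt0)).
  have [v' [[Lv' v'x] /agree_sym a]] := h n; have := hn v' Lv' a.
  by rewrite ltr_norml; lra.
have F0 : F !=set0.
  have [m Lm mmin] := closed_lex_min L Lc shift_nonempty.
  by exists m; split=> //; rewrite phi_mu_min.
have [w [Lw wx] wmax] := closed_lex_max F Fc F0; exists w => //.
apply/eqP; rewrite eq_le wx /= leNgt; apply/negP => ltwx.
case: (max_gap_or_right_limit L Lsh w Lw) => [h|[w' g]|r].
- by have := phi_mu_max w h; lra.
- case: (g) => _ Lw' ww' _; have Fw' : F w' by split; rewrite -?(phi_mu_gap _ _ g).
  by have /lex_leP := wmax w' Fw'.
- have [n hn] := phi_mu_cont w (x - phi_mu w) Lw (ltac:(by rewrite subr_gt0)).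
  have [v [Lv wv a]] := r n; have Fv : F v.
    by split=> //; have := hn v Lv a; rewrite ltr_norml; lra.
  by have /lex_leP := wmax v Fv.
Qed.

(** At a gap the upper word has the same value and is a right limit; the maximum of [L] is excluded
    because its value is 1. *)
Lemma phi_mu_right_surj x : 0 <= x < 1 ->
  exists w, [/\ L w, right_limit L w & phi_mu w = x].
Proof.
move=> /andP[x0 x1]; have [|w Lw wx] := phi_mu_surj x; first by rewrite x0 ltW.
case: (max_gap_or_right_limit L Lsh w Lw) => [/phi_mu_max|[w' g]|r].
- by lra.
- exists w'; split; [by case: g|exact: gap_right_limit g|by rewrite -(phi_mu_gap _ _ g)].
- by exists w.
Qed.

Lemma phi_mu_left_surj x : 0 < x <= 1 ->
  exists w, [/\ L w, left_limit L w & phi_mu w = x].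
Proof.
move=> /andP[x0 x1]; have [|w Lw wx] := phi_mu_surj x; first by rewrite x1 ltW.
case: (min_gap_or_left_limit L w Lsh Lw) => [/(phi_mu_min w Lw)|[w' g]|r].
- by lra.
- exists w'; split; [by case: g|exact: gap_left_limit g|by rewrite (phi_mu_gap _ _ g)].
- by exists w.
Qed.

Lemma phi_mu_right_limit_lt1 w : right_limit L w -> phi_mu w < 1.
Proof.
move=> r; have [v [Lv wv _]] := r 0%N.
exact: lt_le_trans (phi_mu_right_limit _ _ r wv) (phi_mu_le1 v).
Qed.

(** * The shift acting on order intervals *)

Definition shift_itv v w : set (Wmeas a0) := [set s | [/\ L s,
  lex_lt (shiftw v) (shiftw s) & lex_le (shiftw s) (shiftw w)]].

Lemma measurable_shift_itv v w : measurable (shift_itv v w).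
Proof.
rewrite (_ : shift_itv v w = L `&` (shiftw @^-1` lex_itv (shiftw v) (shiftw w))).
  apply: measurableI; first exact: measurable_shift.
  by apply: shiftw_measurable; exact: measurable_lex_itv.
apply/seteqP; split=> s /= => [[Ls h1 h2]|[Ls [_ h1 h2]]]; split=> //; split=> //.
exact: shift_shiftw.
Qed.

(** By invariance, the increment after shifting is the mass of all words whose shift lies in the
    shifted interval, whatever their first letter. *)
Lemma phi_mu_shiftw_sub v w : lex_le v w -> v 0%N = w 0%N ->
  phi_mu (shiftw w) - phi_mu (shiftw v) = mass (shift_itv v w).
Proof.
move=> vw vw0; rewrite phi_mu_sub; last exact/(lex_le_shiftw _ _ vw0).
rewrite -mass_shiftw; last exact: measurable_lex_itv.
rewrite -mass_setIL; last by apply: shiftw_measurable; exact: measurable_lex_itv.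
congr mass; apply/seteqP; split=> s /= => [[Ls [_ h1 h2]]|[Ls h1 h2]]; split=> //.
by split=> //; exact: shift_shiftw.
Qed.

Lemma lex_itv_head v w s : v 0%N = w 0%N -> lex_itv v w s -> s 0%N = v 0%N.
Proof.
move=> vw0 [Ls vs sw]; apply/eqP; rewrite eq_le (lex_le0 v s) ?andbT; last by right.
by rewrite vw0 lex_le0.
Qed.

Lemma lex_itv_sub_shift_itv v w : v 0%N = w 0%N -> lex_itv v w `<=` shift_itv v w.
Proof.
move=> vw0 s h; have s0 := lex_itv_head _ _ _ vw0 h; case: h => Ls vs sw.
split=> //; first exact/(lex_lt_shiftw _ _ (esym s0)).
exact/(lex_le_shiftw _ _ (etrans s0 vw0)).
Qed.

(** Words whose shift is close to [shiftw w] all start with [w 0]. Between words near [w],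
    [shift_itv] thus reduces to [lex_itv], and the shift preserves increments of [phi_mu]. *)
Lemma phi_mu_shiftw_local w : L w -> ~ left_special L (shiftw w) ->
  exists n, forall v, L v -> agree n w v ->
    phi_mu (shiftw v) - phi_mu v = phi_mu (shiftw w) - phi_mu w.
Proof.
move=> Lw nls; have [n hn] := left_extension_locally_constant L Lsh w Lw nls.
exists n.+1.
have key v u : L v -> L u -> lex_le v u -> agree n.+1 w v -> agree n.+1 w u ->
    phi_mu (shiftw u) - phi_mu (shiftw v) = phi_mu u - phi_mu v.
  move=> Lv Lu vu av au; have auv := agree_trans _ _ _ _ (agree_sym _ _ _ av) au.
  have uv0 : v 0%N = u 0%N by exact: auv.
  rewrite phi_mu_shiftw_sub // phi_mu_sub //; congr mass.
  apply/seteqP; split; last exact: lex_itv_sub_shift_itv.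
  move=> s [Ls vs su]; have s0 : s 0%N = v 0%N.
    have -> : v 0%N = w 0%N by rewrite -av.
    have /agreeS[_ av'] := av.
    have /agreeS[_ auv'] := auv.
    apply: hn => //; apply: agree_trans av' _.
    by apply: lex_agree_between auv' => //; right.
  split=> //; first by apply/(lex_lt_shiftw _ _ (esym s0)).
  exact/(lex_le_shiftw _ _ (etrans s0 uv0)).
move=> v Lv a; have [vw|wv] := lex_le_total v w.
  by have := key v w Lv Lw vw a (agree_refl _ _); lra.
by have := key w v Lw Lv wv (agree_refl _ _) a; lra.
Qed.

(* A second right-limit preimage of [shiftw v] contributes extra mass. *)
Lemma phi_mu_shiftw_expand v w y : lex_lt v w -> v 0%N = w 0%N ->
  shiftw y = shiftw v -> y 0%N <> v 0%N -> right_limit L y ->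
  phi_mu w - phi_mu v < phi_mu (shiftw w) - phi_mu (shiftw v).
Proof.
move=> vw vw0 yv y0 ry; rewrite phi_mu_sub ?phi_mu_shiftw_sub //; try by right.
have /(lex_lt_shiftw _ _ vw0)/lex_lt_open[n hn] := vw.
have [t [Lt yt /agreeS[yt0 a]]] := ry n.+1.
have yitv : 0 < mass (lex_itv y t).
  rewrite -phi_mu_sub; last by right.
  by rewrite subr_gt0 phi_mu_right_limit.
have sub : lex_itv v w `|` lex_itv y t `<=` shift_itv v w.
  move=> s [/(lex_itv_sub_shift_itv v w vw0)//|/(lex_itv_sub_shift_itv y t yt0)].
  move=> [Ls ys st]; split=> //; first by rewrite -yv.
  apply: lex_le_trans st _; right; apply: hn => //; rewrite -yv; exact: agree_sym.
apply: lt_le_trans (mass_le _ _ _ (measurable_shift_itv v w) sub).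
  rewrite massU; try exact: measurable_lex_itv; first by rewrite ltrDl.
  apply/seteqP; split=> // s [/(lex_itv_head _ _ _ vw0) e1 /(lex_itv_head _ _ _ yt0) e2].
  by apply: y0; rewrite -e1 -e2.
by apply: measurableU; exact: measurable_lex_itv.
Qed.

(** * The order isomorphism [phi] and the conjugacy *)

Local Notation phi := (phi L mu).
Local Notation T := (T_L L mu).

(** The fibre condition defining [phi] singles out the lower word of a gap: a third word with the
    same value would make some word both end one gap and start another. *)
Lemma phiE w : L w -> phi w = (phi_mu w, `[< exists w', gap L w w' >]).
Proof.
move=> Lw; rewrite /phi.
have -> : (exists w', lex_lt w w' /\ forall v,
    (L v /\ phi_mu v = phi_mu w) <-> (v = w \/ v = w')) = exists w', gap L w w'.
  apply: propext; split=> -[w'].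
    move=> [ww' /(_ w')[_ /(_ (or_intror erefl))[Lw' e]]].
    by exists w'; exact: phi_mu_eq_gap.
  move=> g; exists w'; case: (g) => _ Lw' ww' _; split=> // v; split.
    move=> [Lv e]; have [->|/lex_total[vw|wv]] := EM (v = w); first by left.
      have /gap_right_limit := phi_mu_eq_gap v w Lv Lw vw e.
      by move/(gap_not_right_limit _ _ _ g).
    by right; apply: gap_uniq g; exact: phi_mu_eq_gap.
  by move=> [->//|->]; split=> //; rewrite (phi_mu_gap _ _ g).
by case: asboolP.
Qed.

Lemma phi_right_limit w : L w -> right_limit L w -> phi w = (phi_mu w, false).
Proof.
move=> Lw r; rewrite phiE //; congr pair; apply/asboolP => -[w' g].
exact: gap_not_right_limit g r.
Qed.

Lemma ihat_ltxx (p : R * bool) : ~ ihat_lt p p.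
Proof. by move=> [|[_ [->]]//]; rewrite ltxx. Qed.

Lemma ihat_lt_asym (p q : R * bool) : ihat_lt p q -> ~ ihat_lt q p.
Proof.
move=> [pq|[pq [p2 q2]]] [qp|[qp [q2' p2']]].
- by have := lt_trans pq qp; rewrite ltxx.
- by move: pq; rewrite qp ltxx.
- by move: qp; rewrite pq ltxx.
- by rewrite p2 in p2'.
Qed.

(** Distinct words with equal value form a gap, and the boolean component places its lower word
    before its upper word; in all other cases the values decide. *)
Lemma phi_lt v w : L v -> L w -> ihat_lt (phi v) (phi w) <-> lex_lt v w.
Proof.
have mono v' w' : L v' -> L w' -> lex_lt v' w' -> ihat_lt (phi v') (phi w').
  move=> Lv Lw vw; rewrite !phiE //=.
  have := phi_mu_le _ _ (lex_ltW _ _ vw); rewrite le_eqVlt => /orP[/eqP e|]; last by left.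
  have g := phi_mu_eq_gap _ _ Lv Lw vw e; right; split=> //=; split.
    by apply/asboolP; exists w'.
  apply/asboolP => -[w'' /gap_not_right_limit]; apply; exact: gap_right_limit g.
move=> Lv Lw; split=> [h|]; last exact: mono.
apply/lex_ltP => -[e|wv]; first by move: h; rewrite e => /ihat_ltxx.
exact: ihat_lt_asym h (mono _ _ Lw Lv wv).
Qed.

Lemma phi_Ihat w : L w -> Ihat L mu (phi w).
Proof.
move=> Lw; rewrite phiE //; split=> /=; first by rewrite phi_mu_ge0 phi_mu_le1.
move=> /asboolP[w' g]; split; first by rewrite phi_mu_ge0 phi_mu_le1.
exists w, w'; case: (g) => _ Lw' ww' _; split=> //.
  by move=> e; rewrite -e in ww'; exact: lex_ltxx ww'.
by rewrite (phi_mu_gap _ _ g).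
Qed.

Lemma phi_inj v w : L v -> L w -> phi v = phi w -> v = w.
Proof.
move=> Lv Lw e; apply: contrapT => /lex_total[/(phi_lt _ _ Lv Lw)|/(phi_lt _ _ Lw Lv)];
  by rewrite e => /ihat_ltxx.
Qed.

(** A point [x^-] comes from the lower word of a gap, and [x < 1] from its right-limit word. At
    [x = 1] no word begins a gap, since the upper word of a gap is a right limit and has value below
    1. *)
Lemma phi_surj p : Ihat L mu p -> exists2 w, L w & phi w = p.
Proof.
case: p => x [] [/= x01 hZ].
  have [_ [w1 [w2 [L1 L2 ne e1 e2]]]] := hZ erefl.
  wlog lt12 : w1 w2 L1 L2 ne e1 e2 / lex_lt w1 w2.
    by move=> h; case: (lex_total _ _ ne) => lt; [apply: (h w1 w2)|apply: (h w2 w1)] => // /esym.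
  have g : gap L w1 w2 by apply: phi_mu_eq_gap => //; rewrite e1.
  exists w1 => //; rewrite phiE // e1; congr pair; apply/asboolP; by exists w2.
have [x1|x1] := ltP x 1.
  have [|w [Lw r <-]] := phi_mu_right_surj x; first by case/andP: x01 => ->.
  by exists w => //; exact: phi_right_limit.
have [w Lw wx] := phi_mu_surj x x01; exists w => //.
rewrite phiE // wx; congr pair; apply/asboolP => -[w' g].
have := phi_mu_right_limit_lt1 w' (gap_right_limit _ _ g).
by rewrite -(phi_mu_gap _ _ g) wx ltNge x1.
Qed.

Lemma phi_continuous U : ihat_open L mu U -> rel_open L (L `&` (phi @^-1` U)).
Proof.
move=> [UI hU]; split=> [w []//|w [Lw /hU[lo [hi [hlo hhi h]]]]].
have [n1 h1] : exists n, forall v, L v -> agree n v w ->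
    match lo with Some a => ihat_lt a (phi v) | None => True end.
  case: lo hlo {h} => [a [/phi_surj[u Lu <-] /(phi_lt _ _ Lu Lw)]|_]; last by exists 0%N.
  move=> /lex_lt_open[n hn]; exists n => v Lv a'; apply/phi_lt => //; exact: hn.
have [n2 h2] : exists n, forall v, L v -> agree n v w ->
    match hi with Some a => ihat_lt (phi v) a | None => True end.
  case: hi hhi {h} => [a [/phi_surj[u Lu <-] /(phi_lt _ _ Lw Lu)]|_]; last by exists 0%N.
  move=> /lex_lt_open[n hn]; exists n => v Lv a'; apply/phi_lt => //; exact: hn.
exists (maxn n1 n2) => v Lv a; split=> //; apply: h; first exact: phi_Ihat.
  by apply: h1 => //; apply: agree_le a; exact: leq_maxl.
by apply: h2 => //; apply: agree_le a; exact: leq_maxr.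
Qed.

Lemma phi_open U : rel_open L U -> ihat_open L mu (phi @` U).
Proof.
move=> [UL hU]; split=> [_ [w /UL Lw <-]|_ [w Uw <-]]; first exact: phi_Ihat.
have Lw := UL _ Uw; have [n hn] := hU w Uw.
(* There is no lower bound if [w] is the minimum of [L]; otherwise it is the image of the
   predecessor at a gap, or of a smaller word in the cylinder of length [n]. *)
have [lo [hlo1 hlo2]] : exists lo : option (R * bool),
  match lo with Some a => Ihat L mu a /\ ihat_lt a (phi w) | None => True end /\
  forall v, L v -> match lo with Some a => ihat_lt a (phi v) | None => True end ->
    lex_le v w -> agree n v w.
  case: (min_gap_or_left_limit L w Lsh Lw) => [h|[u g]|/(_ n)[u [Lu uw a]]].
  - exists None; split=> // v Lv _ vw; have -> // := lex_le_anti _ _ vw (h v Lv).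
  - case: (g) => Lu _ uw h; exists (Some (phi u)); split.
      by split; [exact: phi_Ihat|exact/phi_lt].
    move=> v Lv /(phi_lt _ _ Lu Lv) uv vw.
    have -> // := lex_le_anti _ _ vw (h v Lv uv).
  - exists (Some (phi u)); split; first by split; [exact: phi_Ihat|exact/phi_lt].
    move=> v Lv /(phi_lt _ _ Lu Lv) uv vw; apply: agree_trans _ (agree_sym _ _ _ a).
    apply: agree_sym; apply: (lex_agree_between n u v w) => //; first by right.
    exact: agree_sym.
have [hi [hhi1 hhi2]] : exists hi : option (R * bool),
  match hi with Some a => Ihat L mu a /\ ihat_lt (phi w) a | None => True end /\
  forall v, L v -> match hi with Some a => ihat_lt (phi v) a | None => True end ->
    lex_le w v -> agree n v w.
  case: (max_gap_or_right_limit L Lsh w Lw) => [h|[u g]|/(_ n)[u [Lu uw a]]].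
  - exists None; split=> // v Lv _ vw; have -> // := lex_le_anti _ _ vw (h v Lv).
  - case: (g) => _ Lu uw h; exists (Some (phi u)); split.
      by split; [exact: phi_Ihat|exact/phi_lt].
    move=> v Lv /(phi_lt _ _ Lv Lu) uv vw.
    by have -> // := lex_le_anti _ _ vw (gap_lt L _ _ _ g Lv uv).
  - exists (Some (phi u)); split; first by split; [exact: phi_Ihat|exact/phi_lt].
    move=> v Lv /(phi_lt _ _ Lv Lu) uv vw; apply: agree_sym.
    by apply: (lex_agree_between n w v u) => //; right.
exists lo, hi; split=> // _ /phi_surj[v Lv <-] vlo vhi; exists v => //.
apply: hn => //; have [vw|wv] := lex_le_total v w; first exact: hlo2.
exact: hhi2.
Qed.

Lemma That_phi w : L w -> That L mu (phi w) = phi (shiftw w).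
Proof.
move=> Lw; rewrite /That; case: pselect => [h|[]]; last by exists w.
by case: (cid h) => v [Lv /= /(phi_inj _ _ Lv Lw) ->].
Qed.

(** * The map [T_L] read on right-limit words *)

Lemma right_limit_shift w : right_limit L w -> L w.
Proof.
move=> r; apply: (shift_limit L) => // n; have [v [Lv _ /agree_sym a]] := r n.
by exists v.
Qed.

(** The shift sends right limits to right limits, so the image of a point of [[0, 1)] is never of
    the form [x^-]. *)
Lemma That_right_limit w : right_limit L w ->
  That L mu (iotaI (phi_mu w)) = (phi_mu (shiftw w), false).
Proof.
move=> r; have Lw := right_limit_shift _ r.
rewrite /iotaI -(phi_right_limit w) // That_phi // phi_right_limit //.
  exact: shift_shiftw.
exact: right_limit_shiftw.
Qed.

Lemma T_right_limit w : right_limit L w -> T (phi_mu w) = phi_mu (shiftw w).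
Proof. by move=> r; rewrite /T_L That_right_limit. Qed.

Lemma inI_right_limit x : inI x -> exists2 w, right_limit L w & phi_mu w = x.
Proof. by move=> /phi_mu_right_surj[w [Lw r e]]; exists w. Qed.

Lemma right_limit_inI w : right_limit L w -> inI (phi_mu w).
Proof. by move=> r; rewrite /inI phi_mu_ge0 phi_mu_right_limit_lt1. Qed.

Lemma That_iotaI x : inI x -> That L mu (iotaI x) = iotaI (T x).
Proof. by move=> /inI_right_limit[w r <-]; rewrite T_right_limit // That_right_limit. Qed.

Lemma T_maps_I : maps_I T.
Proof.
move=> x /inI_right_limit[w r <-]; rewrite T_right_limit //.
by apply: right_limit_inI; exact: right_limit_shiftw.
Qed.

Lemma iter_T k w : right_limit L w -> iter k T (phi_mu w) = phi_mu (iter k shiftw w).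
Proof.
move=> r; elim: k => [//|k IH]; rewrite !iterS IH T_right_limit //.
exact: right_limit_iter.
Qed.

Lemma T_right_continuous : right_continuous_I T.
Proof.
move=> _ /inI_right_limit[w r <-] e e0; have Lw := right_limit_shift _ r.
have [n hn] := phi_mu_cont (shiftw w) e (shift_shiftw L Lsh _ Lw) e0.
(* Right-limit words with value in [[phi_mu w, phi_mu v)] lie between [w] and [v], so they share
   their prefix of length [n.+1], and the shifts agree on [n] letters. *)
have [v [Lv wv a]] := r n.+1.
exists (phi_mu v - phi_mu w); rewrite subr_gt0 phi_mu_right_limit //; split=> //.
move=> _ /inI_right_limit[u ru <-] /andP[wu]; rewrite addrCA subrr addr0 => uv.
rewrite !T_right_limit //; apply: hn.
  by apply: shift_shiftw => //; exact: right_limit_shift.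
suff /agreeS[_ //] : agree n.+1 w u.
apply: lex_agree_between a; last by right; exact: phi_mu_lt_lex.
by apply/lex_leP => /(phi_mu_right_limit _ _ ru); rewrite ltNge wu.
Qed.

(** * Special values and discontinuities *)

Hypothesis Llin : linear_complexity L.

(** At points of [[0, 1)] outside this set [T_L] is a translation on each available side, possibly
    with different constants. *)
Definition special_value : set R :=
  phi_mu @` [set w | L w /\ left_special L (shiftw w)].

Lemma finite_special_value : finite_set special_value.
Proof.
apply: finite_image.
apply: (@sub_finite_set _ _ ((fun p : A * (nat -> A) => consw p.1 p.2) @`
    ([set: A] `*` [set u | L u /\ left_special L u]))).
  move=> w [Lw lsw]; exists (w 0%N, shiftw w); last by rewrite /= consw_shiftw.
  by split=> //; split=> //; exact: shift_shiftw.
apply: finite_image; apply: finite_setX; first exact: finite_finset.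
exact: (finite_left_special L Lsh shift_nonempty Lmin Llin).
Qed.

Lemma not_special x w : ~ special_value x -> L w -> phi_mu w = x ->
  ~ left_special L (shiftw w).
Proof. by move=> nx Lw wx ls; apply: nx; exists w. Qed.

Lemma T_translation_right x : inI x -> ~ special_value x -> exists e c, 0 < e /\
  forall y, inI y -> x <= y < x + e -> T y = y + c.
Proof.
move=> /inI_right_limit[w r wx] nx; have Lw := right_limit_shift _ r.
have [n hn] := phi_mu_shiftw_local w Lw (not_special x w nx Lw wx).
have [v [Lv wv a]] := r n.
exists (phi_mu v - phi_mu w), (phi_mu (shiftw w) - phi_mu w); split.
  by rewrite subr_gt0 phi_mu_right_limit.
move=> _ /inI_right_limit[u ru <-]; rewrite -wx => /andP[wu uv].
suff au : agree n w u.
  by rewrite T_right_limit //; have := hn u (right_limit_shift _ ru) au; lra.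
apply: lex_agree_between a; last by right; apply: phi_mu_lt_lex; lra.
by apply/lex_leP => /(phi_mu_right_limit _ _ ru); rewrite ltNge wu.
Qed.

Lemma T_translation_left x : 0 < x <= 1 -> ~ special_value x -> exists e c, 0 < e /\
  forall y, inI y -> x - e < y < x -> T y = y + c.
Proof.
move=> /phi_mu_left_surj[w [Lw r wx]] nx.
have [n hn] := phi_mu_shiftw_local w Lw (not_special x w nx Lw wx).
have [v [Lv wv a]] := r n.
exists (phi_mu w - phi_mu v), (phi_mu (shiftw w) - phi_mu w); split.
  by rewrite subr_gt0 phi_mu_left_limit.
move=> _ /inI_right_limit[u ru <-]; rewrite -wx => /andP[vu uw].
suff au : agree n w u.
  by rewrite T_right_limit //; have := hn u (right_limit_shift _ ru) au; lra.
apply: (agree_trans _ _ v) => //.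
apply: (lex_agree_between n v u w); last exact: agree_sym.
  by right; apply: phi_mu_lt_lex; lra.
by right; exact: phi_mu_lt_lex.
Qed.

(** If the right-limit word over [x] were also a left limit, the words of a cylinder around it would
    represent a whole neighbourhood of [x], on which [T] is a translation. *)
Lemma discont_left_isolated x : discont T x -> ~ special_value x ->
  exists w n, left_isolated L n w /\ phi_mu w = x.
Proof.
move=> [Ix dx] nx; have [w r wx] := inI_right_limit x Ix.
have Lw := right_limit_shift _ r; exists w.
apply: contrapT => nex; apply: dx.
have l : left_limit L w.
  move=> n; apply: contrapT => h; apply: nex; exists n; split=> //; split=> // s Ls sw a.
  by apply: h; exists s; split=> //; exact: agree_sym.
have [n hn] := phi_mu_shiftw_local w Lw (not_special x w nx Lw wx).
have [v [Lv vw av]] := l n; have [v' [Lv' wv' av']] := r n.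
apply: (contI_translation T (phi_mu v) (phi_mu v') (phi_mu (shiftw w) - phi_mu w)) => //.
  move=> _ /inI_right_limit[u ru <-] /andP[vu uv'].
  suff au : agree n w u.
    by rewrite T_right_limit //; have := hn u (right_limit_shift _ ru) au; lra.
  apply: (agree_trans _ _ v) => //; apply: (lex_agree_between n v u v').
  - by right; exact: phi_mu_lt_lex.
  - by right; exact: phi_mu_lt_lex.
  - exact: agree_trans (agree_sym _ _ _ av) av'.
by rewrite -wx phi_mu_left_limit // phi_mu_right_limit.
Qed.

Lemma discont_punctured x : 0 < x < 1 -> ~ special_value x -> exists2 e, 0 < e &
  forall y, discont T y -> `|y - x| < e -> y = x.
Proof.
move=> x01 nx; have Ix : inI x by rewrite /inI; lra.
have [e1 [c1 [e10 h1]]] := T_translation_right x Ix nx.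
have [|e2 [c2 [e20 h2]]] := T_translation_left x _ nx; first by lra.
have [e [e0 ee1 ee2]] := ex_lt_both _ _ e10 e20.
exists e => // y [Iy dy]; rewrite ltr_norml => yx; apply: contrapT => /eqP.
rewrite neq_lt => /orP[lt|lt]; apply: dy.
  by apply: (contI_translation T (x - e2) x c2) => //; lra.
apply: (contI_translation T x (x + e1) c1) => //; last by lra.
by move=> u Iu xu; apply: h1 => //; lra.
Qed.

Lemma Dset_punctured x : 0 < x < 1 -> ~ special_value x -> exists2 e, 0 < e &
  forall y, Dset T y -> `|y - x| < e -> y = x.
Proof.
move=> x01 nx; have [e e0 he] := discont_punctured x x01 nx.
exists e => // y [Iy hy] yx; apply: contrapT => /eqP yx'.
have d0 : 0 < `|y - x| by rewrite normr_gt0 subr_eq0.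
have [d [d0' d1 d2]] := ex_lt_both _ (e - `|y - x|) d0 (ltac:(by rewrite subr_gt0)).
have [z [Yz zy]] := hy d d0'.
have zx : z = x.
  apply: he => //; have := ler_normD (z - y) (y - x).
  by rewrite addrA subrK; lra.
by move: zy; rewrite zx distrC; lra.
Qed.

Lemma DsetP x : Dset T x -> ~ special_value x -> x != 0 -> discont T x.
Proof.
move=> Dx nx x0; move: (Dx) => [Ix hx]; move: (Ix); rewrite /inI => Ix'.
have x01 : 0 < x < 1 by rewrite lt_def x0.
have [e e0 he] := discont_punctured x x01 nx.
by have [y [Yy yx]] := hx e e0; rewrite -(he y).
Qed.

Lemma T_const_no_special a b : 0 <= a -> b <= 1 ->
  (forall y, discont T y -> ~ (a < y < b)) ->
  (forall y, special_value y -> ~ (a < y < b)) ->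
  forall y z, a < y < b -> a < z < b -> T y - y = T z - z.
Proof.
move=> ha hb nd ns; apply: (locally_constant_itv (fun y => T y - y)) => z zab.
have Iz : inI z by rewrite /inI; lra.
have nz : ~ special_value z by move/ns.
have [e1 [c1 [e10 h1]]] := T_translation_right z Iz nz.
have [|e2 [c2 [e20 h2]]] := T_translation_left z _ nz; first by lra.
have [e [e0 ee1 ee2]] := ex_lt_both _ _ e10 e20.
have cz : contI T z by apply: contrapT => h; exact: (nd z).
have Tz1 : T z = z + c1 by apply: h1 => //; lra.
have Tz2 : T z = z + c2 by apply: (contI_left_translation T z c2 e2) => //; lra.
exists e => // y yab; rewrite ltr_norml => yz; have Iy : inI y by rewrite /inI; lra.
have [zy|yz'] := leP z y.
  by rewrite Tz1 h1 //; lra.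
by rewrite Tz2 h2 //; lra.
Qed.

(** [T y - y] is locally constant even at a special value [z]: it is constant on each side of [z],
    and right continuity together with continuity at [z] matches both constants with its value
    there. *)
Lemma T_translation_on x x' : 0 <= x -> x < x' -> x' <= 1 ->
  (forall y, discont T y -> ~ (x < y < x')) -> translation_on T x x'.
Proof.
move=> x0 xx' x'1 nd.
have Ix : inI x by rewrite /inI; lra.
have cst : forall y z, x < y < x' -> x < z < x' -> T y - y = T z - z.
  apply: (locally_constant_itv (fun y => T y - y)) => z zx.
  have cz : contI T z by apply: contrapT => h; apply: (nd z) => //; split=> //; rewrite /inI; lra.
  (* The radius [e] isolates [z] from the other special values and keeps the neighbourhood inside
     [(x, x')]. *)
  have [e0 e00 he0] := finite_set_isolated special_value z finite_special_value.
  have [e1 [e10 e1e0 e1z]] := ex_lt_both _ (z - x) e00 (ltac:(lra)).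
  have [e [ep ee1 ez]] := ex_lt_both _ (x' - z) e10 (ltac:(lra)).
  have nds y : special_value y -> `|y - z| < e -> y = z.
    by move=> sy ye; apply: he0 => //; lra.
  have right : forall y, z < y < z + e -> T y = y + (T (z + e / 2) - (z + e / 2)).
    move=> y hy; rewrite -(T_const_no_special z (z + e) _ _ _ _ y) //; try lra.
      by move=> u /nd h hu; apply: h; lra.
    move=> u su hu; suff : u = z by lra.
    by apply: nds => //; rewrite ltr_norml; lra.
  have left : forall y, z - e < y < z -> T y = y + (T (z - e / 2) - (z - e / 2)).
    move=> y hy; rewrite -(T_const_no_special (z - e) z _ _ _ _ y) //; try lra.
      by move=> u /nd h hu; apply: h; lra.
    move=> u su hu; suff : u = z by lra.
    by apply: nds => //; rewrite ltr_norml; lra.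
  have Tr := right_continuous_translation T z (z + e) _ T_right_continuous
    (ltac:(rewrite /inI; lra)) (ltac:(lra)) (ltac:(lra)) right.
  have Tl := contI_left_translation T z _ e cz (ltac:(lra)) ep (fun y _ => left y).
  exists e => // y yx; rewrite ltr_norml => yz.
  case: (ltgtP y z) => [lt|gt|-> //]; last by rewrite right; lra.
  by rewrite left; lra.
pose m := (x + x') / 2; have mx : x < m < x' by rewrite /m; lra.
have cm y : x < y < x' -> T y = y + (T m - m) by move=> /cst /(_ mx); lra.
exists (T m - m) => y /andP[]; rewrite le_eqVlt => /orP[/eqP <- _|xy yx'].
  exact: (right_continuous_translation T x x' _ T_right_continuous).
by apply: cm; rewrite xy.
Qed.

(** Right-limit words over distinct points with the same image differ only in their first letter.
    Without accumulation from the right, [T] is a translation just after [x], whereas the second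
    preimage of the shifted word makes it strictly expanding there. *)
Lemma T_inj x y : inI x -> inI y -> ~ right_acc (Dset T) x -> T x = T y -> x = y.
Proof.
move=> Ix Iy; have [w r wx] := inI_right_limit x Ix; have [v rv vy] := inI_right_limit y Iy.
move=> nacc; rewrite -wx -vy !T_right_limit // => e.
have {}e : shiftw w = shiftw v.
  by apply: phi_mu_right_inj e; exact: right_limit_shiftw.
have [e0|ne0] := EM (v 0%N = w 0%N); first by congr phi_mu; exact: shiftw_inj.
exfalso; have [d d0 hd] : exists2 d, 0 < d & forall z, Dset T z -> ~ (x < z < x + d).
  apply: contrapT => h; apply: nacc => d d0; apply: contrapT => h'; apply: h.
  by exists d => // z Dz xz; apply: h'; exists z.
move: (Ix); rewrite /inI => Ix'.
have [d' [d'0 d'd d'1]] := ex_lt_both d (1 - x) d0 (ltac:(lra)).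
have [c hc] : translation_on T x (x + d').
  apply: T_translation_on; try lra.
  move=> z Yz xz; apply: (hd z); last by lra.
  by case: (Yz) => Iz _; split=> // q q0; exists z; rewrite subrr normr0.
have [n hn] := phi_mu_cont w d' (right_limit_shift _ r) d'0.
have [u [Lu wu a]] := r n.+1.
have ux := hn u Lu (agree_le _ _ _ _ (leqnSn n) a).
have u0 := phi_mu_right_limit _ _ r wu.
rewrite gtr0_norm ?subr_gt0 // in ux.
(* A point strictly between [x] and [phi_mu u] comes from a word between [w] and [u], hence with the
   first letter of [w]. *)
pose z := (x + phi_mu u) / 2.
have zx : x < z < phi_mu u by rewrite /z -wx; lra.
have [|t rt tz] := inI_right_limit z; first by rewrite /inI; lra.
have wt : lex_lt w t by apply: phi_mu_lt_lex; lra.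
have tu : lex_lt t u by apply: phi_mu_lt_lex; lra.
have wt0 : w 0%N = t 0%N.
  by apply: (lex_agree_between 1 w t u (lex_ltW _ _ wt) (lex_ltW _ _ tu)) => //; exact: agree_le a.
have := phi_mu_shiftw_expand w t v wt wt0 (esym e) ne0 rv.
by rewrite -!T_right_limit // wx tz (hc z) ?(hc x); lra.
Qed.

(** These are the cut points between the intervals coded by first letters, on each of which the
    shift is increasing. *)
Definition letter_value (a : A) : R := mass [set v | L v /\ (v 0%N < a)%O].

Lemma T_increasing y z : inI y -> inI z -> y < z ->
  (forall a, ~ (y < letter_value a <= z)) -> T y < T z.
Proof.
move=> /inI_right_limit[v rv <-] /inI_right_limit[w rw <-] vw h.
have mL a : measurable ([set v | L v /\ (v 0%N < a)%O] : set (Wmeas a0)).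
  apply: measurableI; first exact: measurable_shift.
  by apply: measurable_cantor_open => s s0; exists 1%N => s' -> .
have ltvw := phi_mu_lt_lex _ _ vw.
suff e0 : v 0%N = w 0%N.
  rewrite !T_right_limit //; apply: phi_mu_right_limit; first exact: right_limit_shiftw.
  exact/(lex_lt_shiftw _ _ e0).
apply/eqP; rewrite eq_le (lex_le0 v w) ?andTb; last by right.
rewrite leNgt; apply/negP => v0; apply: (h (w 0%N)); apply/andP; split.
  (* As [v] is a right limit, a larger word with the same first letter makes the lower inequality
     strict. *)
  have [u [Lu vu a]] := rv 1%N.
  apply: lt_le_trans (phi_mu_right_limit _ _ rv vu) _.
  apply: mass_le => //; first exact: measurable_lex_le.
  move=> s [Ls su]; split=> //; apply: le_lt_trans (lex_le0 _ _ su) _.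
  by rewrite -(a 0%N).
apply: mass_le => //; first exact: measurable_lex_le.
by move=> s [Ls s0]; split=> //; right; exact: lex_lt0.
Qed.

(** * The interval exchange and its almost finiteness *)

Lemma T_IET : IET T.
Proof.
have [fin|inf] := EM (finite_set (discont T)); [left|right].
  split; first exact: T_maps_I.
    move=> x y Ix Iy; apply: T_inj => // acc.
    have [e e0 he] := finite_set_isolated _ x fin.
    have [y' [[_ hy'] xy']] := acc e e0.
    have [d [d0 d1 d2]] := ex_lt_both (y' - x) (x + e - y') (ltac:(lra)) (ltac:(lra)).
    have [z [Yz]] := hy' d d0; rewrite ltr_norml => zy.
    suff : z = x by lra.
    by apply: he => //; rewrite ltr_norml; lra.
  have /finite_seqP[s sE] := fin.
  have [m [xs [xs0 xsm xslt xs01 xsP]]] := finite_partition s.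
  exists m, xs; split=> // i im; apply: T_translation_on.
  - by have /andP[] := xs01 i (ltnW im).
  - exact: xslt.
  - by have /andP[] := xs01 i.+1 im.
  - by move=> y; rewrite sE /= => /(xsP i y im)/negP.
split; first exact: T_maps_I.
- split=> //.
  have neglc (B : set R) : countable B -> (@lebesgue_measure R).-negligible B.
    move=> cB; apply/negligibleP; last exact: countable_lebesgue_measure0.
    by apply: countable_measurable => // t; exact: measurable_set1.
  (* Away from the special values and 0, the closure consists of values at left isolated words;
     these are countable, since those of length [n] are determined by their prefixes of length
     [n]. *)
  pose B := special_value `|` [set 0] `|`
    \bigcup_n (phi_mu @` [set w | left_isolated L n w]).
  have DB : closI (discont T) `<=` B.
    move=> x Dx; have [sx|nsx] := EM (special_value x); first by left; left.
    have [->|x0] := eqVneq x 0; first by left; right.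
    have [w [n [iw wx]]] := discont_left_isolated x (DsetP x Dx nsx x0) nsx.
    by right; exists n => //; exists w.
  suff [N [mN N0 BN]] : (@lebesgue_measure R).-negligible B.
    by exists N; split=> //; exact: subset_trans DB BN.
  apply: negligibleU; first apply: negligibleU.
  - by apply: neglc; apply: finite_set_countable; exact: finite_special_value.
  - by apply: neglc; apply: finite_set_countable; exact: finite_set1.
  - apply: negligible_bigcup => n; apply: neglc.
    apply: (sub_countable (card_image_le _ _)).
    apply/countable_injP; exists (fun w => pickle (prefix_tuple n w)).
    move=> v w; rewrite !inE => iv iw /(pcan_inj pickleK)/prefix_tupleP.
    exact: left_isolated_agree iv iw.
- by move=> x y Ix Iy nx _; exact: T_inj.
- exact: T_right_continuous.
- move=> x x' [Ix _] Dx' xx' h; move: Ix; rewrite /inI => Ix.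
  apply: T_translation_on => //; first by lra.
    by case: Dx' => [[/andP[_ /ltW//]]|->].
  by move=> y Yy xy; have := h y Yy; lra.
Qed.

Lemma T_almost_finite : almost_finite T.
Proof.
split.
- have [m [xs [xs0 xsm xslt xs01 xsP]]] := finite_partition (map letter_value (enum A)).
  exists m, xs; split=> // i im y z xy yz zx.
  have := xs01 i (ltnW im); have := xs01 i.+1 im => h1 h0.
  apply: T_increasing; rewrite /inI; try lra.
  move=> a ya; have /negP := xsP i (letter_value a) im (map_f _ (mem_enum A a)).
  by apply; lra.
(* The endpoints 0 and 1 are added because [Dset_punctured] concerns interior points. *)
- apply: (@sub_finite_set _ _ (special_value `|` [set 0; 1])).
    move=> x acc; have [sx|nsx] := EM (special_value x); first by left.
    right; apply: contrapT => /= nx.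
    have [x0|x0] := ltP x 0.
      have [y [[Iy _] [_]]] := acc (- x) (ltac:(lra)); rewrite ltr_norml.
      by move: Iy; rewrite /inI; lra.
    have [x1|x1] := ltP 1 x.
      have [y [[Iy _] [_]]] := acc (x - 1) (ltac:(lra)); rewrite ltr_norml.
      by move: Iy; rewrite /inI; lra.
    have x01 : 0 < x < 1.
      by rewrite !lt_neqAle x0 x1 !andbT; apply/andP; split; apply/eqP => e; apply: nx;
        [left|right].
    have [e e0 he] := Dset_punctured x x01 nsx.
    have [y [Dy [yx ye]]] := acc e e0.
    by move/eqP: yx; apply; exact: he.
  by rewrite !finite_setU; split; [exact: finite_special_value|split; exact: finite_set1].
- have [K [w [wiso worb]]] :=
    left_isolated_orbits L Lsh shift_nonempty Lmin Lap Llin.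
  have /finite_seqP[s sE] := finite_special_value.
  (* Left isolated words are right limits, so on their values the iterates of [T] follow the shift
     and orbit equivalence carries over. *)
  have isoR n v : left_isolated L n v -> right_limit L v.
    move=> [Lv hv]; apply: right_or_left_limit => // /(_ n)[u [Lu uv a]].
    by apply: hv (agree_sym _ _ _ a).
  (* The representatives are 0, which [DsetP] leaves aside, the special values in [[0, 1)], and the
     values of the finitely many left isolated words that represent the orbits. *)
  exists (0 :: [seq x <- s | 0 <= x < 1] ++ [seq phi_mu (w k) | k <- enum 'I_K]); split.
    move=> f; rewrite inE mem_cat mem_filter => /or3P[/eqP ->|/andP[]//|/mapP[k _ ->]].
      by rewrite /inI lexx ltr01.
    by have [n /isoR] := wiso k; exact: right_limit_inI.
  move=> d Dd; have [sd|nsd] := EM (special_value d).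
    exists d; last by exists 0%N, 0%N.
    rewrite inE mem_cat mem_filter; apply/or3P; constructor 2; apply/andP; split.
      by case: Dd.
    by move: sd; rewrite sE.
  have [->|d0] := eqVneq d 0; first by exists 0; [rewrite inE eqxx|exists 0%N, 0%N].
  have [v [n [iv <-]]] := discont_left_isolated d (DsetP d Dd nsd d0) nsd.
  have [k [i [j e]]] := worb v n iv.
  exists (phi_mu (w k)).
    rewrite inE mem_cat; apply/or3P; constructor 3; apply/mapP; exists k => //.
    by rewrite mem_enum.
  have [n' iw] := wiso k.
  by exists i, j; rewrite !iter_T ?e //; [exact: isoR iw|exact: isoR iv].
Qed.

End InvariantMeasure.

Theorem theorem2 (R : realType) (dA : Order.disp_t) (A : finOrderType dA) (a0 : A)
  (L : set (nat -> A)) (mu : probability (Wmeas a0) R) :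
  is_shift L -> minimal_shift L -> aperiodic L -> linear_complexity L ->
  mu L = 1%E ->
  (forall B : set (Wmeas a0), measurable B -> mu (shiftw @^-1` B) = mu B) ->
  (* (L, sigma) is topologically conjugate to (hat I, hat T) via the homeomorphism phi *)
  [/\ (* phi maps L into hat I, bijectively *)
      (forall w, L w -> Ihat L mu (phi L mu w)),
      (forall w w', L w -> L w' -> phi L mu w = phi L mu w' -> w = w'),
      (forall p, Ihat L mu p -> exists2 w, L w & phi L mu w = p),
      (* phi is continuous and open (subspace topology on L, order topology on hat I) *)
      (forall U, ihat_open L mu U -> rel_open L (L `&` (phi L mu @^-1` U))) /\
      (forall U, rel_open L U -> ihat_open L mu (phi L mu @` U)) &
      (* conjugacy *)
      (forall w, L w -> That L mu (phi L mu w) = phi L mu (shiftw w))] /\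
  (* hat T extends T_L restricted to I *)
  (forall x, inI x -> That L mu (iotaI x) = iotaI (T_L L mu x)) /\
  (* T_L restricted to I is an almost finite IET *)
  IET (T_L L mu) /\ almost_finite (T_L L mu).
Proof.
move=> Lsh Lmin Lap Llin muL mu_inv; split; first split.
- exact: phi_Ihat.
- exact: phi_inj.
- exact: phi_surj.
- by split; [exact: phi_continuous|exact: phi_open].
- exact: That_phi.
split; first exact: That_iotaI.
by split; [exact: T_IET|exact: T_almost_finite].
Qed.
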